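(* Let $\Phi:\mathbb{C}^{n\times n}\to\mathbb{C}^{m\times m}$ be the completely positive map with Kraus operators $A_1,\dots,A_p\in\mathbb{C}^{m\times n}$, and let $0\le k,r\le n$ be integers. The following are equivalent: (1) $(k,r)\le(k^*,r^* )$ in lexicographic order, i.e., there is no independent set violating $(k,r)$; (2) $\operatorname{cap}_{k,r}\Phi > -\infty$; (3) $\operatorname{cap}_{k',r}\Phi > -\infty$ for $k' = k-\frac{1}{2n}$.
   Context: $\Phi(X)=\sum_i A_iXA_i^\dagger$. A pair of subspaces $L\subseteq\mathbb{C}^m$, $R\subseteq\mathbb{C}^n$ is independent if $x^\dagger A_i y=0$ for all $x\in L$, $y\in R$, $i$. The maximum size $\dim L+\dim R$ of an independent set equals $m+n-k^*$ where $k^* = \operatorname{ncrank}\operatorname{span}\{A_i\}$; among maximum-size independent sets there is a unique one $(L^*,R^* )$ with $L^*$ maximal and $R^*$ minimal (the dominant independent set), and $r^* = \dim R^*$. A pair $(L,R)$ violates $(k,r)$ if $\dim L+\dim R > m+n-k$, or $\dim L+\dim R = m+n-k$ and $\dim R < r$. Let $\mathcal{D}=\{(X,Y,z): X\succeq I_n, Y\succeq I_m \text{ Hermitian}, z\ge0\}$, $f_k(X,Y,z)=\operatorname{Tr}(\Phi(X^{-1})Y^{-1}e^z)+\log\det X+\log\det Y-kz$ (for real $k$), $f_{k,r}(X,Y,z)=f_k(X,Y,z)-\frac1n\sum_{i=n-r+1}^n\lambda_i(\log X)$ where $\lambda_1(H)\ge\dots\ge\lambda_n(H)$ are the eigenvalues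 of a Hermitian $H$ in nonincreasing order, and $\operatorname{cap}_{k,r}\Phi=\inf_{\mathcal{D}}f_{k,r}$. *)

(* Defs.v *)
From HB Require Import structures.
From mathcomp Require Import all_boot all_order all_algebra.
From mathcomp Require Import spectral sesquilinear complex zify.
From mathcomp.multinomials Require Import -(notations) monalg.
From mathcomp Require Import all_classical all_reals all_analysis.

Set Implicit Arguments.
Unset Strict Implicit.
Unset Printing Implicit Defensive.

Import Order.TTheory GRing.Theory Num.Theory.
Local Open Scope ring_scope.
Local Open Scope sesquilinear_scope.
Local Open Scope classical_set_scope.

Definition kraus_map (R : realType) (m n p : nat) (A : 'I_p -> 'M[R[i]]_(m, n))
    (X : 'M[R[i]]_n) : 'M[R[i]]_m :=
  \sum_(i < p) A i *m X *m (A i)^t*.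

Section IndependentSets.
Variables (R : realType) (m n p : nat) (A : 'I_p -> 'M[R[i]]_(m, n)).
Implicit Types (L : {vspace 'cV[R[i]]_m}) (Rs : {vspace 'cV[R[i]]_n}).

Definition independent L Rs : Prop :=
  forall (x : 'cV_m) (y : 'cV_n) (i : 'I_p),
    x \in L -> y \in Rs -> x^t* *m A i *m y = 0.

Definition max_independent L Rs : Prop :=
  independent L Rs /\
  forall L' Rs', independent L' Rs' -> (\dim L' + \dim Rs' <= \dim L + \dim Rs)%N.

Definition dominant L Rs : Prop :=
  max_independent L Rs /\
  forall L' Rs', max_independent L' Rs' -> (L' <= L)%VS /\ (Rs <= Rs')%VS.

(* [k + (\dim L + \dim Rs)] is compared with [m + n] because [-] is truncated
   on nat. *)
Definition violates (k r : nat) L Rs : Prop :=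
  (m + n < k + (\dim L + \dim Rs))%N \/
  (k + (\dim L + \dim Rs) = m + n)%N /\ (\dim Rs < r)%N.

End IndependentSets.

(* The free associative algebra C<x_0, ..., x_(d-1)>: the monoid algebra, over
   C, of the free monoid on 'I_d. *)
Notation free_alg C d := (malg (fmonom 'I_d) C).

Section NoncommutativeRank.
Variables (R : realType) (m n : nat).

(* The linear matrix \sum_i x_i B_i. *)
Definition pencil (d : nat) (B : 'I_d -> 'M[R[i]]_(m, n)) :
    'M[free_alg R[i] d]_(m, n) :=
  \matrix_(a, b) \sum_(i < d) mkmalgU (fmu i) (B i a b).

Definition factors_through (d : nat) (M : 'M[free_alg R[i] d]_(m, n)) (s : nat) :
    Prop :=
  exists (P : 'M[free_alg R[i] d]_(m, s)) (Q : 'M[free_alg R[i] d]_(s, n)), M = P *m Q.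

Lemma ex_factors (d : nat) (M : 'M[free_alg R[i] d]_(m, n)) :
  exists s, `[< factors_through M s >].
Proof. by exists n; apply/asboolP; exists M, 1%:M; rewrite mulmx1. Qed.

(* The inner rank over the free algebra; by Cohn's theorem it is the rank over
   the free skew field. *)
Definition inner_rank (d : nat) (M : 'M[free_alg R[i] d]_(m, n)) : nat :=
  ex_minn (ex_factors M).

Definition ncrank (W : {vspace 'M[R[i]]_(m, n)}) : nat :=
  inner_rank (pencil (fun i : 'I_(\dim W) => (vbasis W)`_i)).

End NoncommutativeRank.

Definition kstar (R : realType) (m n p : nat) (A : 'I_p -> 'M[R[i]]_(m, n)) :
    nat :=
  ncrank <<[seq A i | i <- enum 'I_p]>>%VS.

(* The default value of [xget] is never used: see [dominant_setP] below. *)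
Definition dominant_set (R : realType) (m n p : nat)
    (A : 'I_p -> 'M[R[i]]_(m, n)) :
    {vspace 'cV[R[i]]_m} * {vspace 'cV[R[i]]_n} :=
  xget (0%VS, 0%VS) [set LR | dominant A LR.1 LR.2].

Definition rstar (R : realType) (m n p : nat) (A : 'I_p -> 'M[R[i]]_(m, n)) :
    nat :=
  \dim (dominant_set A).2.

Definition lex_le (a b : nat * nat) : Prop :=
  (a.1 < b.1)%N \/ a.1 = b.1 /\ (a.2 <= b.2)%N.

Section Capacity.
Variable R : realType.

(* The order of R[i] makes [0 <= c] say that c is real and nonnegative. *)
Definition psdmx (n : nat) (H : 'M[R[i]]_n) : Prop :=
  H \is hermsymmx /\ forall v : 'cV_n, 0 <= (v^t* *m H *m v) 0 0.

Definition loewner_ge (n : nat) (H K : 'M[R[i]]_n) : Prop :=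
  [/\ H \is hermsymmx, K \is hermsymmx & psdmx (H - K)].

(* For a Hermitian H: its eigenvalues with multiplicity, in nonincreasing
   order; the i-th one (counted from 1) is item i - 1. *)
Definition eigvals (n : nat) (H : 'M[R[i]]_n) : seq R :=
  sort (fun a b => b <= a)
       [seq complex.Re (spectral_diag H 0 i) | i <- enum 'I_n].

(* Functional calculus: H = U^-1 diag(d) U gives U^-1 diag(ln d) U. *)
Definition logmx (n : nat) (H : 'M[R[i]]_n) : 'M[R[i]]_n :=
  invmx (spectralmx H) *m
  diag_mx (\row_i (ln (complex.Re (spectral_diag H 0 i)))%:C%C) *m
  spectralmx H.

Variables (m n : nat) (Phi : 'M[R[i]]_n -> 'M[R[i]]_m).
Implicit Types (X : 'M[R[i]]_n) (Y : 'M[R[i]]_m) (z : R).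

Definition cap_dom : set ('M[R[i]]_n * 'M[R[i]]_m * R) :=
  [set w | [/\ loewner_ge w.1.1 1%:M, loewner_ge w.1.2 1%:M & 0 <= w.2]].

(* On the domain the trace and the determinants are real, so taking real parts
   loses nothing. *)
Definition f_k (k : R) X Y z : R :=
  complex.Re (\tr (Phi (invmx X) *m invmx Y)) * expR z
  + ln (complex.Re (\det X)) + ln (complex.Re (\det Y)) - k * z.

Definition f_kr (k : R) (r : nat) X Y z : R :=
  f_k k X Y z - n%:R^-1 * \sum_(n - r + 1 <= i < n.+1) (eigvals (logmx X))`_i.-1.

Definition cap (k : R) (r : nat) : \bar R :=
  ereal_inf [set (f_kr k r w.1.1 w.1.2 w.2)%:E | w in cap_dom].

End Capacity.

Section DominantExists.
Variables (R : realType) (m n p : nat) (A : 'I_p -> 'M[R[i]]_(m, n)).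
Implicit Types (L : {vspace 'cV[R[i]]_m}) (Rs : {vspace 'cV[R[i]]_n}).

Lemma independent_add_cap L1 Rs1 L2 Rs2 : independent A L1 Rs1 ->
  independent A L2 Rs2 -> independent A (L1 + L2)%VS (Rs1 :&: Rs2)%VS.
Proof.
move=> I1 I2 x y i /memv_addP[u Lu [v Lv ->]] /memv_capP[y1 y2].
have -> : (u + v)^t* = u^t* + v^t*.
  by apply/matrixP => a b; rewrite !mxE rmorphD.
by rewrite !mulmxDl (I1 _ _ i Lu y1) (I2 _ _ i Lv y2) addr0.
Qed.

Lemma independent_cap_add L1 Rs1 L2 Rs2 : independent A L1 Rs1 ->
  independent A L2 Rs2 -> independent A (L1 :&: L2)%VS (Rs1 + Rs2)%VS.
Proof.
move=> I1 I2 x y i /memv_capP[x1 x2] /memv_addP[u Ru [v Rv ->]].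
by rewrite mulmxDr (I1 _ _ i x1 Ru) (I2 _ _ i x2 Rv) addr0.
Qed.

Lemma max_independent_add_cap L1 Rs1 L2 Rs2 : max_independent A L1 Rs1 ->
  max_independent A L2 Rs2 -> max_independent A (L1 + L2)%VS (Rs1 :&: Rs2)%VS.
Proof.
move=> [I1 M1] [I2 M2]; have I3 := independent_add_cap I1 I2.
have I4 := independent_cap_add I1 I2; split=> // L' Rs' I'.
by have := M1 _ _ I'; have := M1 _ _ I3; have := M1 _ _ I4; have := M2 _ _ I1;
  have := M1 _ _ I2; have := dimv_sum_cap L1 L2; have := dimv_sum_cap Rs1 Rs2; lia.
Qed.

Lemma max_independent_exists : exists L Rs, max_independent A L Rs.
Proof.
pose P d := `[< exists L Rs, independent A L Rs /\ (\dim L + \dim Rs)%N = d >].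
have exP : exists d, P d.
  exists 0; apply/asboolP; exists 0%VS, 0%VS; rewrite !dimv0; split=> //.
  by move=> x y i _; rewrite memv0 => /eqP ->; rewrite mulmx0.
have ubP d : P d -> (d <= \dim {:'cV[R[i]]_m} + \dim {:'cV[R[i]]_n})%N.
  by move=> /asboolP[L [Rs [_ <-]]]; rewrite leq_add// dimvS// subvf.
case: (ex_maxnP exP ubP) => d /asboolP[L [Rs [I0 sz]]] maxd.
exists L, Rs; split=> // L' Rs' I'; rewrite sz; apply: maxd.
by apply/asboolP; exists L', Rs'.
Qed.

Lemma dominant_exists : exists L Rs, dominant A L Rs.
Proof.
pose P d := `[< exists L Rs, max_independent A L Rs /\ \dim L = d >].
have exP : exists d, P d.
  have [L [Rs M0]] := max_independent_exists.
  by exists (\dim L); apply/asboolP; exists L, Rs.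
have ubP d : P d -> (d <= \dim {:'cV[R[i]]_m})%N.
  by move=> /asboolP[L [Rs [_ <-]]]; rewrite dimvS// subvf.
case: (ex_maxnP exP ubP) => d /asboolP[L [Rs [M0 sz]]] maxd.
exists L, Rs; split=> // L' Rs' M'; have M3 := max_independent_add_cap M0 M'.
have dL : (\dim (L + L') <= \dim L)%N.
  by rewrite sz; apply: maxd; apply/asboolP; exists (L + L')%VS, (Rs :&: Rs')%VS.
have eL : (L == L + L')%VS by rewrite eqEdim addvSl dL.
have dR : (\dim Rs <= \dim (Rs :&: Rs'))%N.
  by have := M3.2 _ _ M0.1; lia.
have eR : (Rs :&: Rs' == Rs)%VS by rewrite eqEdim capvSl dR.
by rewrite (eqP eL) addvSr; split=> //; rewrite -(eqP eR) capvSr.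
Qed.

Lemma dominant_unique L1 Rs1 L2 Rs2 :
  dominant A L1 Rs1 -> dominant A L2 Rs2 -> L1 = L2 /\ Rs1 = Rs2.
Proof.
move=> [M1 D1] [M2 D2]; have [a b] := D1 _ _ M2; have [c d] := D2 _ _ M1.
by split; apply: subv_anti; apply/andP.
Qed.

Lemma dominant_setP : dominant A (dominant_set A).1 (dominant_set A).2.
Proof.
rewrite /dominant_set; case: xgetP => [[L Rs] _ //|noD].
by have [L [Rs D]] := dominant_exists; have := noD (L, Rs).
Qed.

End DominantExists.

(* Main.v *)
(* Inner rank and independent sets.  If a linear matrix M factors as P Q over the
   free algebra through s, the weak algorithm brings the factorization to a form
   in which each column of P and the corresponding row of Q have total degree at
   most one.  The s1 constant columns of P and the s - s1 constant rows of Q are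
   then annihilated by subspaces of total dimension at least m + n - s, and these
   form an independent pair.

   Capacity.  Diagonalise X = U^* diag(x) U and Y = W^* diag(y) W with x and y
   nonincreasing and put w_ab = sum_i |(W A_i U^* )_ab|^2, so that
   f_(k,r) = e^z sum_ab w_ab / (x_b y_a) + sum ln x + sum ln y - k z
             - 1/n sum_(b >= n - r) ln x_b        (indices from 0).
   For an independent pair (L, R), take x = 1 on R, y = 1 on L and e^z on the
   orthogonal complements: f_(k,r) is then at most affine in z, and the slope is
   negative when (L, R) is violating.  Conversely, if no pair is violating, then
   for every pair of dimensions that would be violating compactness of the unitary
   groups bounds the sum of w over the corresponding lower right block from
   below.  Hence T = e^z sum w_ab / (x_b y_a) satisfies
   T >= eps e^z / (x_b y_a) for the k pairs a = k - 1 - c, b = c (c < n - r) or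
   b = c + 1 (c >= n - r).  Adding up the k logarithms gives
   f_(k,r) >= T - k ln (T / eps), since the skipped ln x_(n-r) dominates the
   subtracted average. *)
Require Import Defs.
From HB Require Import structures.
From mathcomp Require Import all_boot all_order all_algebra all_fingroup.
From mathcomp Require Import spectral sesquilinear complex zify ring lra.
From mathcomp Require Import finmap.
From mathcomp.multinomials Require Import -(notations) monalg.
From mathcomp Require Import all_classical all_reals all_analysis.

Set Implicit Arguments.
Unset Strict Implicit.
Unset Printing Implicit Defensive.

Import Order.TTheory GRing.Theory Num.Theory.
Local Open Scope ring_scope.
Local Open Scope sesquilinear_scope.

(** * Inner rank over the free algebra *)

Section FreeAlgebraCoefficients.
Variables (K : fieldType) (d : nat).
Implicit Types (f g : free_alg K d) (w : seq 'I_d).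

Definition wcoef w f : K := mcoeff (FMonom w) f.

Lemma wcoefD w f g : wcoef w (f + g) = wcoef w f + wcoef w g.
Proof. exact: mcoeffD. Qed.

Lemma wcoef0 w : wcoef w 0 = 0.
Proof. exact: mcoeff0. Qed.

Lemma wcoef_sum w (I : Type) (r : seq I) (P : pred I) (F : I -> free_alg K d) :
  wcoef w (\sum_(i <- r | P i) F i) = \sum_(i <- r | P i) wcoef w (F i).
Proof. exact: raddf_sum. Qed.

Lemma wcoefU w v (c : K) : wcoef w (mkmalgU (FMonom v) c) = c *+ (v == w).
Proof. by rewrite /wcoef mcoeffU. Qed.

Lemma wcoefE w f :
  wcoef w f = \sum_(v <- msupp f) mcoeff v f *+ (v == w :> seq 'I_d).
Proof.
rewrite /wcoef {1}(monalgE f) raddf_sum; apply: eq_bigr => v _ /=.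
by rewrite mcoeffU fmP.
Qed.

(** Only the cut after [size u] letters can produce [u], so the count is 0 or 1. This turns the
    product over pairs of supports into a sum over the cuts of a word. *)
Lemma cat_take_dropE (u v w : seq 'I_d) :
  (\sum_(i < (size w).+1) ((u == take i w) && (v == drop i w)) = (u ++ v == w))%N.
Proof.
case: eqP => [<-|ne].
  have lt : (size u < (size (u ++ v)).+1)%N by rewrite size_cat ltnS leq_addr.
  rewrite (bigD1 (Ordinal lt)) //= take_size_cat // drop_size_cat // !eqxx.
  rewrite big1 // => i; rewrite -val_eqE /= => ne.
  case: eqP => // /(congr1 size); rewrite size_take_min => us.
  have hi := ltn_ord i; suff: (i : nat) = size u by move/eqP; rewrite (negbTE ne).
  move: hi us; by rewrite ltnS => /minn_idPl ->.
rewrite big1 // => i _; case: (u =P take i w) => //= uE.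
by case: (v =P drop i w) => //= vE; case: ne; rewrite uE vE cat_take_drop.
Qed.

Lemma wcoefM w f g :
  wcoef w (f * g) =
  \sum_(i < (size w).+1) wcoef (take i w) f * wcoef (drop i w) g.
Proof.
transitivity (\sum_(u <- msupp f) \sum_(v <- msupp g)
    (mcoeff u f * mcoeff v g) *+ (u ++ v == w)).
  rewrite /wcoef mcoeffMl; apply: eq_bigr => u _; apply: eq_bigr => v _.
  by rewrite fmP fmM.
symmetry; transitivity (\sum_(i < (size w).+1) \sum_(u <- msupp f)
    \sum_(v <- msupp g) mcoeff u f *+ (u == take i w :> seq 'I_d) *
      (mcoeff v g *+ (v == drop i w :> seq 'I_d))).
  apply: eq_bigr => i _; rewrite !wcoefE mulr_suml.
  by apply: eq_bigr => u _; rewrite mulr_sumr.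
rewrite exchange_big; apply: eq_bigr => u _ /=.
rewrite exchange_big; apply: eq_bigr => v _ /=.
rewrite -(cat_take_dropE u v w) -sumrMnr; apply: eq_bigr => i _.
by case: eqP; case: eqP; rewrite /= ?mulr0n ?mulr1n ?mulr0 ?mul0r.
Qed.

Definition size_le (s : nat) f := forall w, (s <= size w)%N -> wcoef w f = 0.

Lemma size_le_ex f : exists s, size_le s f.
Proof.
exists (\max_(v <- msupp f) (size (v : fmonom _)).+1)%N => w hw.
apply: mcoeff_outdom; apply/negP => wf; move: hw; rewrite leqNgt => /negP[].
have := @leq_bigmax_seq _ _ xpredT (fun v : fmonom 'I_d => (size v).+1) _ wf isT.
by [].
Qed.

Definition homog_of (L : nat) (c : seq 'I_d -> K) : free_alg K d :=
  \sum_(t : L.-tuple 'I_d) mkmalgU (FMonom t) (c t).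

Lemma wcoef_homog L c w :
  wcoef w (homog_of L c) = if size w == L then c w else 0.
Proof.
rewrite wcoef_sum; under eq_bigr => t _ do rewrite wcoefU.
case: eqP => [wL|ne].
  rewrite (bigD1 (Tuple (introT eqP wL))) //= eqxx mulr1n big1 ?addr0 // => t.
  by rewrite -val_eqE /= => /negbTE ->.
rewrite big1 // => t _; case: eqP => // tw.
by case: ne; rewrite -tw size_tuple.
Qed.

End FreeAlgebraCoefficients.

(** * Weak algorithm for factorizations of a linear matrix *)

Section Cohn.
Variables (K : fieldType) (d m n s : nat).
Implicit Types (P : 'M[free_alg K d]_(m, s)) (Q : 'M[free_alg K d]_(s, n)).

Definition col_size_le P (e : 'I_s -> nat) := forall a j, size_le (e j) (P a j).

Lemma wcoef_mulmx w P Q a b :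
  wcoef w ((P *m Q) a b) = \sum_j \sum_(i < (size w).+1)
     wcoef (take i w) (P a j) * wcoef (drop i w) (Q j b).
Proof.
by rewrite mxE wcoef_sum; apply: eq_bigr => j _; rewrite wcoefM.
Qed.

(* The size bound [e j] of column [j] of P is its degree plus one, so a column
   with [e j = 0] vanishes and puts no condition on Q. *)
Definition settled (e : 'I_s -> nat) Q :=
  forall j b v, (0 < e j)%N -> (2 < e j + size v)%N -> wcoef v (Q j b) = 0.

(* Weak algorithm: if P Q has lower degree than its formal leading part, the
   leading forms of the columns of P are right dependent.  Stripping from such
   a relation a shortest word v1 occurring in its coefficients leaves a scalar in
   front of column j1, which the other columns can then shorten. *)
Lemma reduction_step P Q e :
  col_size_le P e ->
  (forall w a b, (2 <= size w)%N -> wcoef w ((P *m Q) a b) = 0) ->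
  ~ settled e Q ->
  exists P' Q' e', [/\ P' *m Q' = P *m Q, col_size_le P' e' &
    (\sum_j e' j < \sum_j e j)%N].
Proof.
move=> Pe PQ /existsNP[j0 /existsNP[b0 /existsNP[v0]]].
move=> /not_implyP[e0 /not_implyP[N0 /eqP Q0]].
(* The largest such [N] is the formal degree of P Q plus one. Failure of [settled] makes it exceed
   2, so the leading part lies in degrees where P Q vanishes. *)
pose Pr N := `[< exists j b v, [/\ (0 < e j)%N, (e j + size v = N)%N &
  wcoef v (Q j b) != 0] >].
have exPr : exists N, Pr N.
  by exists (e j0 + size v0)%N; apply/asboolP; exists j0, b0, v0.
have [D QD] : exists D, forall j b, size_le D (Q j b).
  have /choice[F HF] : forall jb : 'I_s * 'I_n, exists s, size_le s (Q jb.1 jb.2).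
    by move=> jb; exact: size_le_ex.
  exists (\max_jb F jb)%N => j b w hw; apply: (HF (j, b)); apply: leq_trans hw.
  exact: (leq_bigmax (j, b)).
have ubPr N : Pr N -> (N <= \max_j e j + D)%N.
  move=> /asboolP[j [b [v [_ <- /eqP Qn]]]]; rewrite leq_add ?leq_bigmax //.
  by rewrite leqNgt; apply/negP => /ltnW; move/(QD j b).
case: (ex_maxnP exPr ubPr) => N /asboolP[j2 [b [v2 [ej2 N2 Q2]]]] maxN.
have N3 : (2 < N)%N.
  by apply: leq_trans N0 _; apply: maxN; apply/asboolP; exists j0, b0, v0.
have Qhigh j c v : (0 < e j)%N -> (N < e j + size v)%N -> wcoef v (Q j c) = 0.
  move=> ej; rewrite ltnNge => /negP hN; apply/eqP/negPn/negP => hQ; apply: hN.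
  by apply: maxN; apply/asboolP; exists j, c, v.
(* In column [b], take a leading term with [e j1] as large as possible. Since [e j1 + size v1 = N],
   the word [v1] is then a shortest one. *)
pose Pe' E := `[< exists j v, [/\ (0 < e j)%N, (e j + size v = N)%N,
  wcoef v (Q j b) != 0 & e j = E] >].
have exPe : exists E, Pe' E.
  by exists (e j2); apply/asboolP; exists j2, v2.
have ubPe E : Pe' E -> (E <= N)%N.
  by move=> /asboolP[j [v [_ <- _ <-]]]; exact: leq_addr.
case: (ex_maxnP exPe ubPe) => E /asboolP[j1 [v1 [ej1 N1 Q1 E1]]] maxE.
rewrite -{E}E1 in maxE.
have Qlead j v : (e j1 < e j)%N -> (e j + size v = N)%N -> wcoef v (Q j b) = 0.
  move=> hj hN; apply/eqP/negPn/negP => hQ.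
  have : (e j <= e j1)%N by apply: maxE; apply/asboolP; exists j, v; split=> //; lia.
  by rewrite leqNgt hj.
pose c := wcoef v1 (Q j1 b).
pose act j := [&& j != j1, (0 < e j)%N & (e j <= e j1)%N].
(* [h j] is the leading form of [Q j b] with [v1] stripped on the right, normalized by [c]. Its
   degree [e j1 - e j] is exactly what lifts column [j] to the degree of column [j1]. *)
pose h j : free_alg K d := if act j then
  homog_of (e j1 - e j) (fun t => c^-1 * wcoef (t ++ v1) (Q j b)) else 0.
pose G : 'M[free_alg K d]_s := \matrix_(j, l) (if l == j1 then h j else 0).
have h1 : h j1 = 0 by rewrite /h /act eqxx.
(* Square zero makes [1%:M + G] and [1%:M - G] mutually inverse, so the column operation on P is
   undone on Q. *)
have GG : G *m G = 0.
  apply/matrixP => j l; rewrite !mxE big1 // => i _; rewrite !mxE.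
  have [->|_] := eqVneq i j1; last by rewrite mul0r.
  by rewrite h1; case: ifP; rewrite mulr0.
pose e' j := if j == j1 then (e j).-1 else e j.
exists (P *m (1%:M + G)), ((1%:M - G) *m Q), e'; split.
- rewrite mulmxA -[P *m _ *m _]mulmxA mulmxDl mul1mx mulmxBr mulmx1 GG subr0.
  by rewrite subrK mulmx1.
- move=> a l w; rewrite mulmxDr mulmx1 !mxE wcoefD wcoef_sum /e'.
  have [->|ne] := eqVneq l j1; last first.
    move=> hw; rewrite (Pe _ _ _ hw) big1 ?addr0 // => j _.
    by rewrite !mxE (negbTE ne) mulr0 wcoef0.
  move=> hw; under eq_bigr => j _ do rewrite mxE eqxx wcoefM.
  have term0 j : (e j1 <= size w)%N -> (forall i : 'I_(size w).+1,
      wcoef (take i w) (P a j) * wcoef (drop i w) (h j) = 0).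
    move=> hw' i; rewrite /h; case: ifP => [/and3P[_ ej lej]|_]; last first.
      by rewrite wcoef0 mulr0.
    rewrite wcoef_homog size_drop; case: eqP => [hi|_]; last by rewrite mulr0.
    rewrite Pe ?mul0r // size_take_min; have := ltn_ord i; lia.
  have [hw'|] := leqP (e j1) (size w).
    rewrite Pe // add0r big1 // => j _; rewrite big1 // => i _.
    exact: term0.
  (* Only the top degree of column [j1] remains. It is read off from the coefficient of [w ++ v1] in
     P Q, which is zero because this word has length [N.-1], at least 2. *)
  move=> ltw; have sw : size w = (e j1).-1 by lia.
  have sz : size (w ++ v1) = N.-1 by rewrite size_cat; lia.
  have := PQ (w ++ v1) a b; rewrite sz wcoef_mulmx => /(_ _)/wrap[]; first lia.
  have leN (i : 'I_(size (w ++ v1)).+1) : (i <= N.-1)%N by rewrite -sz -ltnS.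
  (* Only the cut after [(e j).-1] letters survives: a longer prefix exceeds the degree of the
     column of P, and a shorter one leaves a suffix too long for Q by maximality of [N]. *)
  have col j : \sum_(i < (size (w ++ v1)).+1) wcoef (take i (w ++ v1)) (P a j) *
      wcoef (drop i (w ++ v1)) (Q j b) =
      if j == j1 then wcoef w (P a j1) * c else
      c * \sum_(i < (size w).+1) wcoef (take i w) (P a j) * wcoef (drop i w) (h j).
    have only (t : nat) : (0 < e j)%N -> t != (e j).-1 -> (t <= N.-1)%N ->
        wcoef (take t (w ++ v1)) (P a j) * wcoef (drop t (w ++ v1)) (Q j b) = 0.
      move=> ej te tN; have [lt|ge] := ltnP t (e j).
        by rewrite [X in _ * X]Qhigh ?mulr0 // size_drop sz; lia.
      by rewrite Pe ?mul0r // size_take_min sz; lia.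
    have [ej0|ej] := posnP (e j).
      have jj1 : j != j1 by apply: contraTneq ej1 => <-; rewrite ej0.
      rewrite (negbTE jj1) /h /act jj1 ej0 /= !big1 ?mulr0 // => i _.
        by rewrite wcoef0 mulr0.
      by rewrite Pe ?mul0r // ej0.
    have [jE|jj1] := eqVneq j j1.
      have ht : (size w < (size (w ++ v1)).+1)%N by rewrite sz; lia.
      rewrite (bigD1 (Ordinal ht)) //= take_size_cat // drop_size_cat // jE.
      rewrite big1 ?addr0 // => i; rewrite -val_eqE /= => iw.
      by rewrite -jE; apply: only => //; rewrite jE -sw.
    have [lej|gtj] := leqP (e j) (e j1); last first.
      rewrite /h /act jj1 ej leqNgt gtj /= [X in _ = _ * X]big1; last first.
        by move=> i _; rewrite wcoef0 mulr0.
      rewrite mulr0 big1 // => i _; have hi := leN i.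
      have [iE|ne] := eqVneq (i : nat) (e j).-1; last exact: only.
      by rewrite [X in _ * X]Qlead ?mulr0 // size_drop iE sz; lia.
    have ht : ((e j).-1 < (size (w ++ v1)).+1)%N by rewrite sz; lia.
    have ht' : ((e j).-1 < (size w).+1)%N by lia.
    rewrite (bigD1 (Ordinal ht)) //= [X in _ + X]big1 ?addr0; last first.
      by move=> i; rewrite -val_eqE /= => iw; exact: only.
    rewrite (bigD1 (Ordinal ht')) //= [X in _ = _ * (_ + X)]big1 ?addr0; last first.
      move=> i; rewrite -val_eqE /= => iw; rewrite /h /act jj1 ej lej /= wcoef_homog.
      rewrite size_drop; case: eqP => [hi|_]; last by rewrite mulr0.
      by have := ltn_ord i; lia.
    rewrite /h /act jj1 ej lej /= wcoef_homog size_drop ifT; last by apply/eqP; lia.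
    rewrite take_cat drop_cat sw; case: ltnP => [lt|ge].
      by rewrite mulrCA mulVKf // mulrCA.
    have -> : ((e j).-1 - (e j1).-1 = 0)%N by lia.
    rewrite take0 drop0 cats0 take_oversize ?sw // drop_oversize ?sw //=.
    by rewrite mulrCA mulVKf.
  rewrite (eq_bigr _ (fun j _ => col j)) (bigD1 j1) //= eqxx => hz.
  apply: (mulfI Q1); rewrite -/c mulr0 mulrDr [c * wcoef w _]mulrC -[RHS]hz.
  congr (_ + _); rewrite mulr_sumr [LHS](bigD1 j1) //= h1.
  rewrite [X in c * X + _]big1 ?mulr0 ?add0r; last by move=> i _; rewrite wcoef0 mulr0.
  by apply: eq_bigr => j /negbTE ->.
- rewrite (bigD1 j1) //= [X in (_ < X)%N](bigD1 j1) //= /e' eqxx.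
  by rewrite (eq_bigr e) ?ltn_add2r ?prednK // => j /negbTE ->.
Qed.

(** Terminates because each reduction step lowers [\sum_j e j]. *)
Lemma settled_factorization P Q e :
  col_size_le P e ->
  (forall w a b, (2 <= size w)%N -> wcoef w ((P *m Q) a b) = 0) ->
  exists P' Q' e', [/\ P' *m Q' = P *m Q, col_size_le P' e' & settled e' Q'].
Proof.
have [N] := ubnP (\sum_j e j)%N; elim: N P Q e => // N IH P Q e.
rewrite ltnS => eN Pe PQ.
have [st|nst] := pselect (settled e Q); first by exists P, Q, e.
have [P1 [Q1 [e1 [PQ1 Pe1 lt]]]] := reduction_step Pe PQ nst.
have [|P2 [Q2 [e2 [PQ2 Pe2 st2]]]] := IH P1 Q1 e1 (leq_trans lt eN) Pe1.
  by move=> w a b hw; rewrite PQ1 PQ.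
exists P2, Q2, e2; split; [exact (etrans PQ2 PQ1) | exact Pe2 | exact st2].
Qed.

End Cohn.

Lemma sum_mulrn_eq (V : nmodType) (I : finType) (F : I -> V) (i : I) :
  \sum_l F l *+ (l == i) = F i.
Proof.
by rewrite (bigD1 i) //= eqxx mulr1n big1 ?addr0 // => l /negbTE ->.
Qed.

Lemma linear_product_kernels (K : fieldType) (d m n s : nat)
    (B : 'I_d -> 'M[K]_(m, n))
    (P : 'M[free_alg K d]_(m, s)) (Q : 'M[free_alg K d]_(s, n)) :
  (forall a b, (P *m Q) a b = \sum_i mkmalgU (fmu i) (B i a b)) ->
  exists s1 s2 (P0 : 'M[K]_(m, s1)) (Q0 : 'M[K]_(s2, n)),
    (s1 + s2 = s)%N /\ forall (x : 'rV_m) (y : 'cV_n) i,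
      x *m P0 = 0 -> Q0 *m y = 0 -> x *m B i *m y = 0.
Proof.
move=> PQB.
have PQw w a b : wcoef w ((P *m Q) a b) = \sum_i B i a b *+ ([:: i] == w).
  by rewrite PQB wcoef_sum; apply: eq_bigr => i _; rewrite fmuE wcoefU.
have [e Pe] : exists e, col_size_le P e.
  have /choice[F HF] : forall aj : 'I_m * 'I_s, exists s, size_le s (P aj.1 aj.2).
    by move=> aj; exact: size_le_ex.
  exists (fun j => \max_a F (a, j))%N => a j w hw; apply: (HF (a, j)).
  by apply: leq_trans hw; exact: (leq_bigmax a).
have [|P' [Q' [e' [PQ' Pe' st]]]] := settled_factorization Pe (Q := Q).
  move=> w a b hw; rewrite PQw big1 // => i _.
  by case: eqP => // wi; rewrite -wi in hw.
(* Columns of [P'] indexed by [J] are constant. Outside [J] the size bound is at least 2, and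
   [settled] forces the row of [Q'] to be constant. *)
pose J := [set j | e' j <= 1]%N.
pose cP w := \matrix_(a, j) wcoef w (P' a j).
pose cQ w := \matrix_(j, b) wcoef w (Q' j b).
have BE i : B i = cP [::] *m cQ [:: i] + cP [:: i] *m cQ [::].
  apply/matrixP => a b; have := PQw [:: i] a b; rewrite -PQ' wcoef_mulmx.
  have -> : \sum_l B l a b *+ ([:: l] == [:: i]) = B i a b.
    rewrite -[RHS](sum_mulrn_eq (fun l => B l a b)); apply: eq_bigr => l _.
    by rewrite eqseq_cons andbT.
  move=> <-; rewrite !mxE -big_split; apply: eq_bigr => j _.
  by rewrite big_ord_recl big_ord1 !mxE.
clear PQB PQw PQ' Pe; exists #|J|, #|~: J|, (\matrix_(a, c) cP [::] a (enum_val c)),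
  (\matrix_(c, b) cQ [::] (enum_val c) b).
split=> [|x y i xP Qy]; first by rewrite cardsC card_ord.
have xP0 j : j \in J -> (x *m cP [::]) 0 j = 0.
  move=> jJ; have /matrixP/(_ 0 (enum_rank_in jJ j)) := xP; rewrite !mxE => h.
  rewrite -[RHS]h; apply: eq_bigr => a _; rewrite [in RHS]mxE.
  by rewrite enum_rankK_in.
have Qy0 j : j \notin J -> (cQ [::] *m y) j 0 = 0.
  rewrite -finset.in_setC => jJ; have /matrixP/(_ (enum_rank_in jJ j) 0) := Qy.
  rewrite !mxE => h; rewrite -[RHS]h; apply: eq_bigr => a _; rewrite [in RHS]mxE.
  by rewrite enum_rankK_in.
rewrite BE mulmxDr mulmxDl; apply/matrixP => a b; rewrite !ord1 {a b}.
rewrite mxE -!mulmxA (mulmxA x (cP [:: i])) (mulmxA x (cP [::])).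
rewrite [X in X + _]mxE [X in _ + X]mxE -big_split big1 ?mxE // => j _ /=.
(* For [j] in [J] the linear part of the column is zero and [x] kills its constant part; otherwise
   the same holds for the row, with [y]. *)
have [jJ|jJ] := boolP (j \in J).
  rewrite xP0 // mul0r add0r mulrC.
  have -> : (x *m cP [:: i]) 0 j = 0; last by rewrite mulr0.
  rewrite mxE big1 // => a _; rewrite mxE Pe' ?mulr0 //.
  by move: jJ; rewrite inE.
rewrite Qy0 // mulr0 addr0 [X in _ * X]mxE big1 ?mulr0 // => b _.
move: jJ; rewrite inE -ltnNge => ej; rewrite mxE st ?mul0r //=; lia.
Qed.

(** * Passing between matrices and subspaces of column vectors *)

Lemma dim_cV (K : fieldType) (n : nat) : \dim {:'cV[K]_n} = n.
Proof. by rewrite dimvf dim_matrix; exact: muln1. Qed.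

Lemma dim_le_cV (C : fieldType) (n : nat) (V : {vspace 'cV[C]_n}) : (\dim V <= n)%N.
Proof. by rewrite -[X in (_ <= X)%N](dim_cV C) dimvS ?subvf. Qed.

Lemma kernel_vspace (K : fieldType) (q n : nat) (M : 'M[K]_(q, n)) :
  exists V : {vspace 'cV[K]_n},
    (n <= q + \dim V)%N /\ forall y, y \in V -> M *m y = 0.
Proof.
pose f : 'Hom('cV[K]_n, 'cV[K]_q) := linfun (mulmx M).
exists (lker f); split=> [|y]; last by rewrite memv_ker lfunE => /eqP.
have hk := limg_ker_dim f fullv; rewrite capfv dim_cV in hk.
apply: leq_trans (eq_leq (esym hk)) _; rewrite addnC leq_add2r.
exact: dim_le_cV.
Qed.

Section ConjugateRowSpace.
Variable C : numClosedFieldType.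

(** The rows are the conjugate transposes of a basis of [V]. This makes rank and orthogonality
    results for row spaces available and matches the [x^t*] in [independent]. *)
Lemma vspace_rows (m : nat) (V : {vspace 'cV[C]_m}) :
  exists M : 'M[C]_(\dim V, m), row_free M /\ forall u, (u *m M)^t* \in V.
Proof.
pose M := \matrix_(i < \dim V) ((vbasis V)`_i)^t*.
have ME u : (u *m M)^t* = \sum_i (u 0 i)^* *: (vbasis V)`_i.
  apply/matrixP => a b; rewrite ord1 !mxE rmorph_sum summxE.
  by apply: eq_bigr => i _; rewrite !mxE rmorphM /= conjCK.
exists M; split=> [|u]; last first.
  rewrite ME rpred_sum // => i _; rewrite rpredZ //.
  by apply: vbasis_mem; rewrite mem_nth // size_tuple.
apply: inj_row_free => u uM; have := ME u; rewrite uM trmx0 map_mx0 => /esym.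
have /freeP fr := basis_free (vbasisP V); move/fr => u0.
by apply/matrixP => a i; rewrite ord1 mxE -[LHS]conjCK u0 conjC0.
Qed.

Lemma rows_vspace (l m : nat) (M : 'M[C]_(l, m)) : row_free M ->
  exists V : {vspace 'cV[C]_m},
    \dim V = l /\ forall x, x \in V -> exists u : 'cV_l, x = M^t* *m u.
Proof.
move=> Mfree; pose f : 'Hom('cV[C]_l, 'cV[C]_m) := linfun (mulmx (M^t*)).
exists (limg f); split=> [|x /memv_imgP[u _ ->]]; last by exists u; rewrite lfunE.
rewrite limg_dim_eq ?dim_cV //; apply/eqP; rewrite capfv -subv0.
apply/subvP => u; rewrite memv_ker lfunE /= memv0 => /eqP Mu.
have : u^t* *m M = 0 by rewrite -[M]trmxCK -map_mxM -trmx_mul Mu trmx0 map_mx0.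
rewrite -(mul0mx _ M) => /(row_free_inj Mfree) u0.
by rewrite -[u]trmxCK u0 trmx0 map_mx0.
Qed.

End ConjugateRowSpace.

(** The identity splits along the row space of [M] and a complement. The second summand has rank at
    most [m - \rank M] and factors through its rank. *)
Lemma row_space_split (K : fieldType) (l m : nat) (M : 'M[K]_(l, m)) :
  exists s (Z : 'M[K]_(m, l)) (K1 : 'M[K]_(m, s)) (K2 : 'M[K]_(s, m)),
    (s <= m - \rank M)%N /\ 1%:M = Z *m M + K1 *m K2.
Proof.
have /sub_addsmxP[[Z Z']] : (1%:M <= M + M^C)%MS.
  by rewrite submx_full // addsmx_compl_full.
move=> /= ->.
exists (\rank (Z' *m M^C)%MS), Z, (col_base (Z' *m M^C)%MS), (row_base (Z' *m M^C)%MS).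
by rewrite mulmx_base -mxrank_compl mxrankM_maxr.
Qed.

Lemma const_mul_pencil (R : realType) (m n s d : nat)
    (K1 : 'M[R[i]]_(s, m)) (B : 'I_d -> 'M[R[i]]_(m, n)) :
  map_mx (mkmalgU (fmone _)) K1 *m pencil B = pencil (fun i => K1 *m B i).
Proof.
apply/matrixP => a b; rewrite !mxE.
under [RHS]eq_bigr => i _ do rewrite mxE raddf_sum.
rewrite exchange_big; apply: eq_bigr => l _ /=; rewrite !mxE mulr_sumr.
by apply: eq_bigr => i _; rewrite malgM_def fgmulUU mul1m.
Qed.

Lemma pencil_mul_const (R : realType) (m n s d : nat)
    (K1 : 'M[R[i]]_(n, s)) (B : 'I_d -> 'M[R[i]]_(m, n)) :
  pencil B *m map_mx (mkmalgU (fmone _)) K1 = pencil (fun i => B i *m K1).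
Proof.
apply/matrixP => a b; rewrite !mxE.
under [RHS]eq_bigr => i _ do rewrite mxE raddf_sum.
rewrite exchange_big; apply: eq_bigr => l _ /=; rewrite !mxE mulr_suml.
by apply: eq_bigr => i _; rewrite malgM_def fgmulUU mulm1.
Qed.

(** * Factorizations of a pencil and independent pairs *)

Section InnerRankIndependent.
Variables (R : realType) (m n : nat).
Local Notation C := R[i].

(** Splitting the identity on both sides of [B i], the term seen by both [L] and [Rs] vanishes by
    independence. The other two terms factor through complements of [L] and [Rs], with one factor
    constant and the other linear. *)
Lemma independent_factors (d : nat) (B : 'I_d -> 'M[C]_(m, n)) L Rs :
  independent B L Rs ->
  exists s, (s + (\dim L + \dim Rs) <= m + n)%N /\ factors_through (pencil B) s.
Proof.
move=> ind.
have [Lm [Lfree LmP]] := vspace_rows L.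
have [Rm [Rfree RmP]] := vspace_rows Rs.
have [s1 [Z1 [K1 [K2 [s1le K12]]]]] := row_space_split Lm.
have [s2 [Z2 [T1 [T2 [s2le T12]]]]] := row_space_split Rm.
move: s1le s2le; rewrite (eqP Lfree) (eqP Rfree) => s1le s2le.
have dL := dim_le_cV L; have dR := dim_le_cV Rs.
exists (s1 + s2)%N; split.
  by rewrite addnACA leq_add // addnC -leq_subRL.
have T12' : 1%:M = Rm^t* *m Z2^t* + T2^t* *m T1^t*.
  have := congr1 (fun X => X^t*) T12.
  by rewrite /= linearD /= map_mxD !trmx_mul !map_mxM trmx1 map_mx1.
have BE i : B i = K1 *m (K2 *m B i) + Z1 *m Lm *m B i *m T2^t* *m T1^t*.
  have LBR : Lm *m B i *m Rm^t* = 0.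
    apply/matrixP => a b; have := ind _ _ i (LmP (delta_mx 0 a)) (RmP (delta_mx 0 b)).
    rewrite trmxCK -!rowE -row_mul => /matrixP/(_ 0 0); rewrite !mxE => h.
    by rewrite -[RHS]h; apply: eq_bigr => j _; rewrite !mxE.
  rewrite -[LHS]mul1mx K12 mulmxDl addrC mulmxA; congr (_ + _).
  rewrite -[LHS]mulmx1 T12' mulmxDr.
  have -> : Z1 *m Lm *m B i *m (Rm^t* *m Z2^t*) =
            Z1 *m (Lm *m B i *m Rm^t*) *m Z2^t* by rewrite !mulmxA.
  by rewrite LBR mulmx0 mul0mx add0r mulmxA.
exists (row_mx (map_mx (mkmalgU (fmone _)) K1)
               (pencil (fun i => Z1 *m Lm *m B i *m T2^t*))).
exists (col_mx (pencil (fun i => K2 *m B i)) (map_mx (mkmalgU (fmone _)) (T1^t*))).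
rewrite mul_row_col const_mul_pencil pencil_mul_const.
apply/matrixP => a b; rewrite !mxE -big_split; apply: eq_bigr => i _ /=.
by rewrite -raddfD {1}BE mxE.
Qed.

Lemma factors_independent (d s : nat) (B : 'I_d -> 'M[C]_(m, n)) :
  factors_through (pencil B) s ->
  exists L Rs, (m + n <= s + (\dim L + \dim Rs))%N /\ independent B L Rs.
Proof.
move=> [P [Q PQ]].
have [|s1 [s2 [P0 [Q0 [sE ker]]]]] := @linear_product_kernels _ _ _ _ _ B P Q.
  by move=> a b; rewrite -PQ mxE.
have [L [dL LP]] := kernel_vspace (P0^t*).
have [Rs [dR RP]] := kernel_vspace Q0.
exists L, Rs; split; first by rewrite -sE addnACA leq_add.
move=> x y i xL yR; apply: ker; last exact: RP.
by rewrite -[P0]trmxCK -map_mxM -trmx_mul LP // trmx0 map_mx0.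
Qed.

End InnerRankIndependent.

(** * Lexicographic order against [kstar] and [rstar] *)

Section KstarRstar.
Variables (R : realType) (m n p : nat) (A : 'I_p -> 'M[R[i]]_(m, n)).
Implicit Types (L : {vspace 'cV[R[i]]_m}) (Rs : {vspace 'cV[R[i]]_n}).

Let W : {vspace 'M[R[i]]_(m, n)} := <<[seq A i | i <- enum 'I_p]>>%VS.
Let B := fun i : 'I_(\dim W) => (vbasis W)`_i.

(** Independence is linear in the matrices, so it may be tested on the basis of the span from which
    [kstar] is computed. *)
Lemma independent_span L Rs : independent A L Rs <-> independent B L Rs.
Proof.
split=> ind x y i xL yR.
  have : B i \in W by apply: vbasis_mem; rewrite mem_nth // size_tuple.
  move=> /(@coord_span _ _ _ (in_tuple _)) ->.
  rewrite mulmx_sumr mulmx_suml big1 // => j _.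
  have /mapP[l _ ->] : (in_tuple [seq A i | i <- enum 'I_p])`_j
      \in [seq A i | i <- enum 'I_p] by rewrite mem_nth.
  by rewrite -scalemxAr -scalemxAl ind // scaler0.
have AW : A i \in W by apply: memv_span; apply: map_f; rewrite mem_enum.
rewrite (coord_vbasis AW) mulmx_sumr mulmx_suml big1 // => j _.
by rewrite -scalemxAr -scalemxAl ind // scaler0.
Qed.

Lemma kstar_max_independent L Rs : max_independent A L Rs ->
  (kstar A + (\dim L + \dim Rs) = m + n)%N.
Proof.
move=> [ind maxLR]; rewrite /kstar /ncrank /inner_rank.
case: ex_minnP => s /asboolP fs mins; apply/eqP; rewrite eqn_leq; apply/andP; split.
  have [s' [les' fs']] := independent_factors (iffLR (independent_span L Rs) ind).
  by apply: leq_trans les'; rewrite leq_add2r; apply: mins; apply/asboolP.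
have [L' [Rs' [le ind']]] := factors_independent fs.
apply: leq_trans le _; rewrite leq_add2l; apply: maxLR.
exact: (iffRL (independent_span L' Rs')).
Qed.

(** The dominant set decides: it has maximum size, and among independent sets of that size its
    second component has the least dimension. So it violates [(k, r)] as soon as any independent set
    does. *)
Lemma lex_le_no_violation (k r : nat) :
  lex_le (k, r) (kstar A, rstar A) <->
  ~ (exists L Rs, independent A L Rs /\ violates k r L Rs).
Proof.
have [maxD domD] := dominant_setP A; have kE := kstar_max_independent maxD.
split=> [|noV].
  move=> lek [L [Rs [ind vio]]]; have := maxD.2 _ _ ind.
  case: lek => /= [lt|[kk rr]] lek; first by case: vio => [|[]]; lia.
  case: vio => [|[sz lt]]; first lia.
  have maxLR : max_independent A L Rs.
    by split=> // L' Rs' ind'; have := maxD.2 _ _ ind'; lia.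
  have [_ /dimvS] := domD _ _ maxLR; rewrite -/(rstar A); lia.
rewrite /lex_le /=; have [lt|gt|eqk] := ltngtP k (kstar A); first by left.
  case: noV; exists (dominant_set A).1, (dominant_set A).2.
  by split; [exact: maxD.1 | left; lia].
right; split=> //; rewrite leqNgt; apply/negP => lt; case: noV.
exists (dominant_set A).1, (dominant_set A).2; split; first exact: maxD.1.
by right; split; [lia | exact: lt].
Qed.

End KstarRstar.

(** * Capacity in spectral coordinates *)

Lemma nonincreasing_perm (R : realDomainType) (n : nat) (f : 'I_n -> R) :
  exists s : 'S_n, forall i j : 'I_n, (i <= j)%N -> f (s j) <= f (s i).
Proof.
pose leT (i j : 'I_n) := f j <= f i.
pose t := sort leT (enum 'I_n).
have szt : size t = n by rewrite size_sort size_enum_ord.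
have ut : uniq t by rewrite sort_uniq enum_uniq.
have leTr : transitive leT by move=> j i k ji kj; exact: le_trans kj ji.
have st : sorted leT t by apply: sort_sorted => i j; exact: le_total.
case: n => [|n] in f leT t szt ut leTr st *; first by exists 1%g; case.
pose g (i : 'I_n.+1) := nth ord0 t i.
have ginj : injective g.
  move=> i j /eqP; rewrite nth_uniq ?szt // => /eqP; exact: val_inj.
exists (perm ginj) => i j ij; rewrite !permE.
by apply: (sorted_leq_nth leTr (fun _ => lexx _)) => //; rewrite inE szt.
Qed.

Lemma ln_prod_ord (R : realType) (n : nat) (x : 'I_n -> R) : (forall i, 0 < x i) ->
  ln (\prod_i x i) = \sum_i ln (x i).
Proof.
move=> x0; pose K (a b : R) := 0 < a /\ ln a = b.
suff [] : K (\prod_i x i) (\sum_i ln (x i)) by [].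
apply: (big_rec2 K); first by split=> //; rewrite ln1.
by move=> i a b _ [b0 <-]; split; [rewrite mulr_gt0 | rewrite lnM ?posrE].
Qed.

Lemma char_poly_similar (K : fieldType) (n : nat) (U D : 'M[K]_n) :
  U \in unitmx -> char_poly (invmx U *m D *m U) = char_poly D.
Proof.
move=> Uu; rewrite /char_poly /char_poly_mx.
pose Vp := map_mx polyC (invmx U); pose Up := map_mx polyC U.
have VU : Vp *m Up = 1%:M by rewrite -map_mxM mulVmx // map_mx1.
have -> : 'X%:M - map_mx polyC (invmx U *m D *m U) =
          Vp *m ('X%:M - map_mx polyC D) *m Up.
  rewrite !map_mxM mulmxBr mulmxBl; congr (_ - _).
  by rewrite scalar_mxC -mulmxA VU mulmx1.
have dVU : \det Vp * \det Up = 1 by rewrite -det_mulmx VU det1.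
by rewrite !det_mulmx mulrAC dVU mul1r.
Qed.

Lemma char_poly_diag (K : fieldType) (n : nat) (d : 'rV[K]_n) :
  char_poly (diag_mx d) = \prod_(c <- [seq d 0 i | i <- enum 'I_n]) ('X - c%:P).
Proof.
rewrite char_poly_trig ?diag_mx_is_trig // big_map big_enum.
by apply: eq_bigr => i _; rewrite mxE eqxx mulr1n.
Qed.

(** Both diagonals list the roots of the same characteristic polynomial. *)
Lemma spectral_diag_unique (C : numClosedFieldType) (n : nat) (U : 'M[C]_n) d :
  U \is unitarymx -> U^t* *m diag_mx d *m U \is normalmx ->
  perm_eq [seq spectral_diag (U^t* *m diag_mx d *m U) 0 i | i <- enum 'I_n]
          [seq d 0 i | i <- enum 'I_n].
Proof.
move=> Uu; set H := U^t* *m _ *m _ => /orthomx_spectralP HE.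
have e1 : char_poly H = char_poly (diag_mx (spectral_diag H)).
  by rewrite {1}HE (char_poly_similar _ (spectral_unit _)).
have e2 : char_poly H = char_poly (diag_mx d).
  by rewrite /H -(invmx_unitary Uu) (char_poly_similar _ (unitarymx_unit Uu)).
by move: e1; rewrite e2 !char_poly_diag => /esym/prod_XsubC_eq.
Qed.

Section UnitaryDiagonal.
Variable R : realType.
Local Notation C := R[i].

(** For unitary [U] the eigenvectors are the vectors [(row i U)^t*], in the convention of
    [spectralmx]. *)
Definition udiag (n : nat) (U : 'M[C]_n) (x : 'I_n -> R) : 'M[C]_n :=
  U^t* *m diag_mx (\row_i (x i)%:C%C) *m U.

Lemma conjC_real (a : R) : (a%:C%C : C)^* = a%:C%C.
Proof. by rewrite conj_Creal // complex_real. Qed.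

Lemma udiag_entry n (U : 'M[C]_n) x a b :
  udiag U x a b = \sum_j (U j a)^* * (x j)%:C%C * U j b.
Proof.
rewrite /udiag mul_mx_diag mxE; apply: eq_bigr => j _; rewrite !mxE //.
Qed.

Lemma trmxC_udiag n (U : 'M[C]_n) x : (udiag U x)^t* = udiag U x.
Proof.
apply/matrixP => a b; rewrite 2!mxE !udiag_entry rmorph_sum.
by apply: eq_bigr => j _; rewrite !rmorphM /= conjCK conjC_real mulrC mulrA mulrAC.
Qed.

Lemma hermsymP n (H : 'M[C]_n) : reflect (H^t* = H) (H \is hermsymmx).
Proof.
apply: (iffP (is_hermitianmxP _ _ _)); rewrite expr0 scale1r; exact: esym.
Qed.

Lemma udiag_herm n (U : 'M[C]_n) x : udiag U x \is hermsymmx.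
Proof. by apply/hermsymP; rewrite trmxC_udiag. Qed.

Lemma unitary_trmxCl n (U : 'M[C]_n) : U \is unitarymx -> U^t* *m U = 1%:M.
Proof. by move/unitarymxP/mulmx1C. Qed.

Lemma udiag1 n (U : 'M[C]_n) : U \is unitarymx -> udiag U (fun=> 1) = 1%:M.
Proof.
move=> Uu; rewrite -(unitary_trmxCl Uu); apply/matrixP => a b.
by rewrite udiag_entry mxE; apply: eq_bigr => j _; rewrite !mxE mulr1.
Qed.

Lemma udiagM n (U : 'M[C]_n) x y : U \is unitarymx ->
  udiag U x *m udiag U y = udiag U (fun i => x i * y i).
Proof.
move=> /unitarymxP Uu; rewrite /udiag; set Dx := diag_mx _; set Dy := diag_mx _.
have -> : U^t* *m Dx *m U *m (U^t* *m Dy *m U) =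
          U^t* *m (Dx *m (U *m U^t*) *m Dy) *m U by rewrite !mulmxA.
rewrite Uu mulmx1 mulmx_diag; apply: (congr1 (fun d => U^t* *m diag_mx d *m U)).
by apply/matrixP => a b; rewrite !mxE rmorphM.
Qed.

Lemma invmx_udiag n (U : 'M[C]_n) x : U \is unitarymx -> (forall i, x i != 0) ->
  invmx (udiag U x) = udiag U (fun i => (x i)^-1).
Proof.
move=> Uu x0; have xV : udiag U x *m udiag U (fun i => (x i)^-1) = 1%:M.
  rewrite udiagM // -(udiag1 Uu); congr (udiag U _).
  by apply/funext => i; rewrite divff.
have [xu _] := mulmx1_unit xV.
by rewrite -[RHS](mulKmx xu) xV mulmx1.
Qed.

Lemma det_udiag n (U : 'M[C]_n) x : U \is unitarymx ->
  \det (udiag U x) = (\prod_i x i)%:C%C.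
Proof.
move=> Uu; rewrite /udiag !det_mulmx mulrAC -det_mulmx unitary_trmxCl // det1 mul1r.
by rewrite det_diag rmorph_prod; apply: eq_bigr => i _; rewrite mxE.
Qed.

Lemma hermitian_udiag n (H : 'M[C]_n) : H \is hermsymmx ->
  exists (U : 'M[C]_n) x, [/\ U \is unitarymx,
    forall i j : 'I_n, (i <= j)%N -> x j <= x i & H = udiag U x].
Proof.
move=> Hh; pose V := spectralmx H.
pose y i := complex.Re (spectral_diag H 0 i).
have Vu : V \is unitarymx := spectral_unitarymx H.
have HE : H = udiag V y.
  have /orthomx_spectralP -> := hermitian_normalmx Hh.
  rewrite (invmx_unitary Vu) /udiag.
  apply: (congr1 (fun d => V^t* *m diag_mx d *m V)).
  apply/matrixP => a b; rewrite ord1 mxE /y.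
  have /mxOverP/(_ 0 b) := hermitian_spectral_diag_real Hh.
  by move=> /RRe_real ->.
have [s sP] := nonincreasing_perm y.
have V'u : row_perm s V \is unitarymx.
  apply/unitarymxP/matrixP => a b; have /unitarymxP/matrixP/(_ (s a) (s b)) := Vu.
  rewrite !mxE (inj_eq perm_inj) => <-; apply: eq_bigr => j _; by rewrite !mxE.
exists (row_perm s V), (y \o s); split=> //.
rewrite HE; apply/matrixP => a b; rewrite !udiag_entry (reindex_inj (@perm_inj _ s)).
by apply: eq_bigr => j _; rewrite !mxE.
Qed.

Lemma psdmx_udiag n (U : 'M[C]_n) x : U \is unitarymx ->
  psdmx (udiag U x) <-> forall i, 0 <= x i.
Proof.
move=> Uu.
have formE v : (v^t* *m udiag U x *m v) 0 0 =
    \sum_i (x i)%:C%C * (((U *m v) i 0)^* * (U *m v) i 0).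
  have -> : v^t* *m udiag U x *m v =
      (U *m v)^t* *m diag_mx (\row_i (x i)%:C%C) *m (U *m v).
    by rewrite /udiag trmx_mul map_mxM !mulmxA.
  rewrite mul_mx_diag mxE; apply: eq_bigr => i _; rewrite mxE mulrAC mulrC.
  by congr (_ * (_ * _)); rewrite !mxE.
split=> [[_ psd] i|x0].
  have := psd (U^t* *m delta_mx i 0); rewrite formE mulmxA (unitarymxP Uu) mul1mx.
  rewrite (bigD1 i) //= big1 => [|j ji]; rewrite !mxE ?eqxx ?(negbTE ji) /=.
    by rewrite conjC1 !mulr1 addr0 ler0c.
  by rewrite mulr0 mulr0.
split=> [|v]; first exact: udiag_herm.
by rewrite formE sumr_ge0 // => i _; rewrite mulr_ge0 ?ler0c // mulrC mul_conjC_ge0.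
Qed.

Lemma loewner_udiag n (U : 'M[C]_n) x : U \is unitarymx ->
  loewner_ge (udiag U x) 1%:M <-> forall i, 1 <= x i.
Proof.
move=> Uu; have BE : udiag U x - 1%:M = udiag U (fun i => x i - 1).
  rewrite -(udiag1 Uu); apply/matrixP => a b.
  rewrite mxE [X in _ + X]mxE !udiag_entry -sumrB.
  by apply: eq_bigr => j _; rewrite rmorphB /= mulrBr mulrBl.
split=> [[_ _]|x1].
  by rewrite BE psdmx_udiag // => h i; rewrite -subr_ge0 h.
split; first exact: udiag_herm.
  by rewrite -(udiag1 Uu) udiag_herm.
by rewrite BE; apply/psdmx_udiag => // i; rewrite subr_ge0.
Qed.

Lemma spectral_diag_udiag n (U : 'M[C]_n) x : U \is unitarymx ->
  perm_eq [seq complex.Re (spectral_diag (udiag U x) 0 i) | i <- enum 'I_n]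
          [seq x i | i <- enum 'I_n].
Proof.
move=> Uu; have := spectral_diag_unique Uu (hermitian_normalmx (udiag_herm U x)).
move=> /(perm_map (@complex.Re R)); rewrite -!map_comp; congr (perm_eq _ _).
by apply: eq_map => i /=; rewrite mxE.
Qed.

Lemma eigvals_udiag n (U : 'M[C]_n) x : U \is unitarymx ->
  eigvals (udiag U x) = sort >=%R [seq x i | i <- enum 'I_n].
Proof.
move=> Uu; apply/perm_sortP => [a b|a b c|a b|]; first exact: le_total.
- by move=> h1 h2; apply: le_trans h2 h1.
- by rewrite andbC; apply: le_anti.
exact: spectral_diag_udiag.
Qed.

(** [logmx] uses its own diagonalization, whose eigenvalues agree with [x] only up to order; sorting
    removes the difference. *)
Lemma eigvals_logmx_udiag n (U : 'M[C]_n) x : U \is unitarymx ->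
  eigvals (logmx (udiag U x)) = sort >=%R [seq ln (x i) | i <- enum 'I_n].
Proof.
move=> Uu; rewrite /logmx invmx_unitary ?spectral_unitarymx //.
rewrite -/(udiag _ _) eigvals_udiag ?spectral_unitarymx //.
apply/perm_sortP => [a b|a b c|a b|]; first exact: le_total.
- by move=> h1 h2; apply: le_trans h2 h1.
- by rewrite andbC; apply: le_anti.
have := perm_map (@ln R) (spectral_diag_udiag x Uu).
by rewrite -!map_comp.
Qed.

End UnitaryDiagonal.

Lemma mxtrace_conj_diag (C : numClosedFieldType) (m n : nat)
    (A : 'M[C]_(m, n)) (U : 'M[C]_n) (W : 'M[C]_m) (x : 'rV[C]_n) (y : 'rV[C]_m)
    (G := W *m A *m U^t*) :
  \tr (A *m (U^t* *m diag_mx x *m U) *m A^t* *m (W^t* *m diag_mx y *m W)) =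
  \sum_a \sum_b `|G a b| ^+ 2 * (x 0 b * y 0 a).
Proof.
have -> : \tr (A *m (U^t* *m diag_mx x *m U) *m A^t* *m (W^t* *m diag_mx y *m W)) =
    \tr (G *m diag_mx x *m G^t* *m diag_mx y).
  by rewrite 2!mulmxA mxtrace_mulC /G !trmx_mul !map_mxM trmxCK !mulmxA.
rewrite /mxtrace; apply: eq_bigr => a _; rewrite mul_mx_diag mxE.
rewrite [in X in X * _]mxE mulr_suml; apply: eq_bigr => b _.
rewrite mul_mx_diag !mxE normCK; ring.
Qed.

(** * The capacity functional in terms of eigenvalues *)

Section CapacityFormula.
Variables (R : realType) (m n p : nat) (A : 'I_p -> 'M[R[i]]_(m, n)).
Local Notation C := R[i].

Definition weight (U : 'M[C]_n) (W : 'M[C]_m) a b : C :=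
  \sum_i `|(W *m A i *m U^t*) a b| ^+ 2.

Lemma weight_ge0 U W a b : 0 <= weight U W a b.
Proof. by rewrite sumr_ge0 // => i _; rewrite exprn_ge0. Qed.

Lemma Re_weight_ge0 U W a b : 0 <= complex.Re (weight U W a b).
Proof. by have := weight_ge0 U W a b; rewrite lecE => /andP[]. Qed.

Lemma tr_kraus_udiag U W (x : 'I_n -> R) (y : 'I_m -> R) :
  complex.Re (\tr (kraus_map A (udiag U x) *m udiag W y)) =
  \sum_a \sum_b complex.Re (weight U W a b) * (x b * y a).
Proof.
have -> : \tr (kraus_map A (udiag U x) *m udiag W y) =
    \sum_a \sum_b weight U W a b * (x b * y a)%:C%C.
  rewrite /kraus_map mulmx_suml raddf_sum /=.
  transitivity (\sum_(i < p) \sum_a \sum_b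
      `|(W *m A i *m U^t*) a b| ^+ 2 * (x b * y a)%:C%C).
    apply: eq_bigr => i _; rewrite mxtrace_conj_diag.
    by do 2!apply: eq_bigr => ? _; rewrite !mxE rmorphM.
  rewrite exchange_big; apply: eq_bigr => a _ /=.
  by rewrite exchange_big; apply: eq_bigr => b _ /=; rewrite mulr_suml.
rewrite raddf_sum; apply: eq_bigr => a _; rewrite raddf_sum; apply: eq_bigr => b _.
by case: (weight U W a b) => u v; rewrite /= mulr0 subr0.
Qed.

Lemma f_kr_udiag (k : R) r U W (x : 'I_n -> R) (y : 'I_m -> R) z :
  U \is unitarymx -> W \is unitarymx ->
  (forall b, 0 < x b) -> (forall a, 0 < y a) ->
  (forall b b' : 'I_n, (b <= b')%N -> x b' <= x b) -> (r <= n)%N ->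
  f_kr (kraus_map A) k r (udiag U x) (udiag W y) z =
  (\sum_a \sum_b complex.Re (weight U W a b) / (x b * y a)) * expR z
  + \sum_b ln (x b) + \sum_a ln (y a) - k * z
  - n%:R^-1 * \sum_(b < n | (n - r <= b)%N) ln (x b).
Proof.
move=> Uu Wu x0 y0 xd rn.
have xn0 b : x b != 0 by rewrite gt_eqF.
have yn0 a : y a != 0 by rewrite gt_eqF.
rewrite /f_kr /f_k !invmx_udiag // tr_kraus_udiag !det_udiag // eigvals_logmx_udiag //.
rewrite !ln_prod_ord //.
have nthE (b : 'I_n) : [seq ln (x i) | i <- enum 'I_n]`_b = ln (x b).
  by rewrite (nth_map b) ?size_enum_ord // nth_ord_enum.
(* As [x] is nonincreasing, sorting changes nothing and item [b] is [ln (x b)]. *)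
have srt : sorted >=%R [seq ln (x i) | i <- enum 'I_n].
  rewrite sorted_pairwise; last by move=> a b c h1 h2; apply: le_trans h2 h1.
  have szE : size [seq ln (x i) | i <- enum 'I_n] = n by rewrite size_map size_enum_ord.
  apply/(pairwiseP 0) => i j; move=> hi hj ij.
  have ni : (i < n)%N by rewrite -szE.
  have nj : (j < n)%N by rewrite -szE.
  have /= -> := nthE (Ordinal ni); have /= -> := nthE (Ordinal nj).
  suff : ln (x (Ordinal nj)) <= ln (x (Ordinal ni)) by [].
  by rewrite ler_ln ?posrE // xd // ltnW.
rewrite sorted_sort //; last by move=> a b c h1 h2; apply: le_trans h2 h1.
congr (_ - _ * _); last first.
  (* Eigenvalues are counted from 1 and ordinals from 0, so the last [r] of them are the indices [b]
     with [n - r <= b]. *)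
  rewrite addn1 big_add1 /= (big_nat_widenl _ 0) // big_mkord.
  by apply: eq_bigr => b _; rewrite nthE.
congr (_ * _ + _ + _ - _); apply: eq_bigr => a _; apply: eq_bigr => b _.
by rewrite invfM.
Qed.

Lemma cap_gtNy (k : R) r :
  (-oo < cap (kraus_map A) k r)%E <->
  exists M, forall w, cap_dom w -> M <= f_kr (kraus_map A) k r w.1.1 w.1.2 w.2.
Proof.
split=> [|[M MP]]; last first.
  apply: (@lt_le_trans _ _ M%:E); first by rewrite ltNyr.
  by apply: le_ereal_inf_tmp => _ [w wD <-]; rewrite lee_fin MP.
move=> cgt; have lb w : cap_dom w ->
    (cap (kraus_map A) k r <= (f_kr (kraus_map A) k r w.1.1 w.1.2 w.2)%:E)%E.
  by move=> wD; apply: ereal_inf_lbound; exists w.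
move: cgt lb; case: (cap _ _ _) => [c| |] // _ lb; last by exists 0 => w /lb.
by exists c => w /lb.
Qed.

(** Since [z] is nonnegative on the domain, lowering [k] raises the functional pointwise. *)
Lemma cap_antitone (k k' : R) r : k' <= k ->
  (-oo < cap (kraus_map A) k r)%E -> (-oo < cap (kraus_map A) k' r)%E.
Proof.
move=> kk /cap_gtNy[M MP]; apply/cap_gtNy; exists M => w wD.
apply: le_trans (MP _ wD) _; have [_ _ z0] := wD; rewrite /f_kr /f_k.
by rewrite lerD2r lerD2l lerN2 ler_wpM2r.
Qed.

End CapacityFormula.

(** * A violating pair drives the functional to minus infinity *)

Lemma unitary_square_col_mx (C : numClosedFieldType) (n n1 n2 : nat)
    (M1 : 'M[C]_(n1, n)) (M2 : 'M[C]_(n2, n)) :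
  (n1 + n2 = n)%N -> col_mx M1 M2 \is unitarymx ->
  exists U : 'M[C]_n, U \is unitarymx /\
    forall i : 'I_n, (n1 <= i)%N -> exists j, row i U = row j M2.
Proof.
move=> nE Uu; exists (castmx (nE, erefl) (col_mx M1 M2)).
have castE (i : 'I_n) : exists i' : 'I_(n1 + n2), (i' = i :> nat) /\
    row i (castmx (nE, erefl) (col_mx M1 M2)) = row i' (col_mx M1 M2).
  exists (cast_ord (esym nE) i); split=> //.
  by apply/rowP => j; rewrite !mxE castmxE cast_ord_id /= mxE.
split=> [|i].
  apply/row_unitarymxP => i j; have [i' [ii' ->]] := castE i.
  have [j' [jj' ->]] := castE j; have /row_unitarymxP -> := Uu.
  by rewrite -!val_eqE /= ii' jj'.
have [i' [<- ->]] := castE i; case: (split_ordP i') => j -> /= ij.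
  by move: (ltn_ord j); rewrite ltnNge ij.
by exists j; rewrite rowKd.
Qed.

Local Notation "B ^!" :=
  (orthomx Num.conj (mx_of_hermitian (hermitian1mx _)) B) : matrix_set_scope.

(** An orthonormal basis of the complement is completed by one of [V]. The part in [V] comes last
    because [V] is to carry the smallest eigenvalue, 1, in a nonincreasing list. *)
Lemma unitary_adapted (C : numClosedFieldType) (n : nat) (V : {vspace 'cV[C]_n}) :
  exists U : 'M[C]_n, U \is unitarymx /\
    forall i : 'I_n, (n - \dim V <= i)%N -> (row i U)^t* \in V.
Proof.
have [M [Mfree MV]] := vspace_rows V.
pose O := (M^!)%MS; have rO : (\rank O = n - \dim V)%N.
  by rewrite rank_ortho (eqP Mfree).
have inV i : (row i (schmidt (row_base O^!%MS)))^t* \in V.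
  have : (row i (schmidt (row_base O^!%MS)) <= M)%MS.
    apply: submx_trans (row_sub _ _) _.
    by rewrite eqmx_schmidt_free ?row_base_free // eq_row_base ortho_id.
  by move=> /submxP[u ->].
have [U [Uu UP]] :=
  unitary_square_col_mx (add_rank_ortho O) (schmidt_complete_unitarymx O).
by exists U; split=> // i; rewrite -rO => /UP[j ->].
Qed.

Lemma sum_step (R : realType) (n c : nat) (P : pred 'I_n) (t : R) :
  \sum_(i < n | P i) (if (i < c)%N then t else 0) =
  t *+ \sum_(i < n | P i) (i < c).
Proof.
rewrite -sumrMnr; apply: eq_bigr => i _; by case: ifP.
Qed.

Lemma card_ord_interval (n l c : nat) : (c <= n)%N ->
  (\sum_(i < n | l <= i) (i < c) = c - l)%N.
Proof.
move=> cn.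
transitivity (\sum_(0 <= i < n | (l <= i) && (i < c)) 1)%N.
  by rewrite big_mkord [RHS]big_mkcondr; apply: eq_bigr => i _; case: ltnP.
transitivity (\sum_(l <= i < c) 1)%N; last by rewrite sum_nat_const_nat muln1.
rewrite [RHS](big_nat_widen _ _ n) // [RHS](big_nat_widenl _ 0) //.
by apply: eq_bigl => i; rewrite andbC.
Qed.

Section ViolationUnbounded.
Variables (R : realType) (m n p : nat) (A : 'I_p -> 'M[R[i]]_(m, n)).

Lemma violation_unbounded (k r : nat) L Rs :
  (0 < n)%N -> (r <= n)%N -> independent A L Rs -> violates k r L Rs ->
  ~ (-oo < cap (kraus_map A) (k%:R - (2 * n%:R)^-1) r)%E.
Proof.
move=> n0 rn ind vio /cap_gtNy[M MP].
have [U [Uu UP]] := unitary_adapted Rs.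
have [W [Wu WP]] := unitary_adapted L.
pose l := \dim L; pose s := \dim Rs.
have dL : (l <= m)%N := dim_le_cV L; have dR : (s <= n)%N := dim_le_cV Rs.
have {}vio : (m + n < k + (l + s))%N \/ (k + (l + s) = m + n)%N /\ (s < r)%N := vio.
have {}UP : forall b : 'I_n, (n - s <= b)%N -> (row b U)^t* \in Rs := UP.
have {}WP : forall a : 'I_m, (m - l <= a)%N -> (row a W)^t* \in L := WP.
clearbody l s.
have w0 (a : 'I_m) (b : 'I_n) : (m - l <= a)%N -> (n - s <= b)%N -> weight A U W a b = 0.
  move=> ha hb; rewrite /weight big1 // => i _.
  have := ind _ _ i (WP a ha) (UP b hb); rewrite trmxCK -row_mul => /matrixP/(_ 0 0).
  rewrite !mxE => h; rewrite [X in `|X|](_ : _ = 0) ?normr0 ?expr0n //.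
  by rewrite -[RHS]h; apply: eq_bigr => j _; rewrite !mxE.
pose T := \sum_a \sum_b complex.Re (weight A U W a b).
(* [g] is the slope in [z]: [m - l] and [n - s] eigenvalues equal [expR z], and [r - s] (truncated)
   of the latter are among the last [r]. *)
pose g : R := (m - l)%:R + (n - s)%:R - (k%:R - (2 * n%:R)^-1) - n%:R^-1 * (r - s)%:R.
have nR : 0 < n%:R :> R by rewrite ltr0n.
have g0 : g < 0.
  rewrite /g invfM; set q : R := n%:R^-1; have q0 : 0 < q by rewrite invr_gt0.
  have q1 : q <= 1 by rewrite invf_le1 // ler1n.
  (* A violation in size gives slope at most -1 + 1/(2n), one in [r] at most 1/(2n) - 1/n. The shift
     of [k] by 1/(2n) leaves both negative. *)
  case: vio => [lt|[eq lt]].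
    have lt' : ((m - l) + (n - s) + 1 <= k)%N by lia.
    have qr : 0 <= q * (r - s)%:R by rewrite mulr_ge0 // ltW.
    have := lt'; rewrite -(ler_nat R) !natrD; lra.
  have kE : k = (m - l + (n - s))%N by lia.
  have qr : q * 1 <= q * (r - s)%:R by rewrite ler_pM2l // ler1n subn_gt0.
  by rewrite kE natrD; lra.
(* Large enough for [T + g * z <= M - 1], and nonnegative to stay in the domain. *)
pose z := Num.max 0 ((T - M + 1) / - g).
have z0 : 0 <= z by rewrite le_max lexx.
pose x (b : 'I_n) : R := if (b < n - s)%N then expR z else 1.
pose y (a : 'I_m) : R := if (a < m - l)%N then expR z else 1.
have ez : 1 <= expR z by rewrite -expR0 ler_expR.
have x1 b : 1 <= x b by rewrite /x; case: ifP.
have y1 a : 1 <= y a by rewrite /y; case: ifP.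
have xd (b b' : 'I_n) : (b <= b')%N -> x b' <= x b.
  by rewrite /x => bb'; case: ltnP => h1; case: ltnP => h2 //; lia.
have lnx b : ln (x b) = if (b < n - s)%N then z else 0.
  by rewrite /x; case: ifP; rewrite ?expRK ?ln1.
have lny a : ln (y a) = if (a < m - l)%N then z else 0.
  by rewrite /y; case: ifP; rewrite ?expRK ?ln1.
have := MP (udiag U x, udiag W y, z).
rewrite f_kr_udiag //=; first last.
- by move=> a; apply: lt_le_trans (y1 a).
- by move=> b; apply: lt_le_trans (x1 b).
move=> /(_ _)/wrap[]; first by split; [exact/loewner_udiag | exact/loewner_udiag | ].
(* Outside the block of zero weights, [x b] or [y a] equals [expR z] and absorbs that factor. *)
have leT : (\sum_a \sum_b complex.Re (weight A U W a b) / (x b * y a)) * expR z <= T.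
  rewrite mulr_suml; apply: ler_sum => a _; rewrite mulr_suml; apply: ler_sum => b _.
  have [/andP[ha hb]|nh] := boolP ((m - l <= a)%N && (n - s <= b)%N).
    by rewrite w0 //= !mul0r.
  have xy0 : 0 < x b * y a.
    by rewrite mulr_gt0 ?(lt_le_trans _ (x1 b)) ?(lt_le_trans _ (y1 a)).
  rewrite mulrAC ler_pdivrMr // ler_wpM2l ?Re_weight_ge0 //.
  move: nh; rewrite negb_and -!ltnNge => /orP[h|h].
    by rewrite {1}/y h ler_peMl // (le_trans _ ez).
  by rewrite {1}/x h ler_peMr // (le_trans _ ez).
rewrite (eq_bigr _ (fun b _ => lnx b)) (eq_bigr _ (fun a _ => lny a)).
rewrite (eq_bigr _ (fun b _ => lnx b)) !sum_step.
have card0 (N c : nat) : (c <= N)%N -> (\sum_(i < N) (i < c) = c)%N.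
  by move=> cN; have := @card_ord_interval N 0 c cN; rewrite subn0.
rewrite !card0 ?leq_subr // card_ord_interval ?leq_subr //.
have -> : (n - s - (n - r) = r - s)%N by lia.
have gz : T - M + 1 <= - g * z.
  rewrite mulrC -ler_pdivrMr ?oppr_gt0 //.
  by rewrite /z le_max lexx orbT.
have : g * z = z *+ (m - l) + z *+ (n - s) - (k%:R - (2 * n%:R)^-1) * z
    - n%:R^-1 * (z *+ (r - s)).
  by rewrite /g !mulrBl mulrDl !mulr_natl -mulrA mulr_natl.
by move: gz leT; rewrite mulNr; lra.
Qed.

End ViolationUnbounded.

(** * Lower bound for the capacity *)

Import numFieldNormedType.Exports.

(** * Compactness of the unitary groups *)

Section PositiveOnCompact.
Local Open Scope classical_set_scope.

(** The image under [g] of the zeros of [f] in the cube is compact, hence closed, and misses 0, so a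
    ball around 0 misses it too. No minimum is chosen, so an empty zero set needs no separate
    case. *)
Lemma compact_pos_lower_bound (R : realType) (N : nat) (f g : 'rV[R]_N -> R) :
  continuous f -> continuous g ->
  (forall v : 'rV[R]_N, (forall i, -1 <= v 0 i <= 1) -> f v = 0 -> 0 < g v) ->
  exists2 e, 0 < e & forall v : 'rV[R]_N,
    (forall i, -1 <= v 0 i <= 1) -> f v = 0 -> e <= g v.
Proof.
move=> cf cg pos.
pose K := [set v : 'rV[R]_N | forall i, `[-1, 1]%classic (v ord0 i)] `&` f @^-1` [set 0].
have cK : compact K.
  apply: compact_closedI.
    apply: (@rV_compact _ N (fun=> `[(-1 : R), 1]%classic)) => i.
    exact: segment_compact.
  by apply: closed_comp => [v _|]; [exact: cf | exact: closed_eq].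
have cgK : compact (g @` K).
  by apply: continuous_compact => //; exact: continuous_subspaceT.
have := compact_closed (@norm_hausdorff _ _) cgK; rewrite -openC openE => ogK.
have KP v : K v <-> (forall i, -1 <= v 0 i <= 1) /\ f v = 0.
  split=> -[Kv fv]; split; try exact: fv.
    by move=> i; have := Kv i; rewrite /= in_itv.
  by move=> i; rewrite /= in_itv; exact: Kv.
have /ogK : (~` (g @` K)) 0.
  by move=> [v /KP[Kv fv] gv0]; have := pos _ Kv fv; rewrite gv0 ltxx.
rewrite /interior -nbhs_ballE => -[e /= e0 ball_e]; exists e => // v Kv fv.
rewrite leNgt; apply/negP => lt; apply: (ball_e (g v)); last by exists v => //; apply/KP.
by rewrite -ball_normE /ball_ /= sub0r normrN gtr0_norm // pos.
Qed.

End PositiveOnCompact.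

Section ComplexContinuity.
Variables (R : realType) (T : topologicalType).
Implicit Types f g : T -> R[i].

(** Stated through real and imaginary parts so that only the topology of [R] enters. *)
Definition ccontinuous f :=
  continuous (fun v => complex.Re (f v)) /\ continuous ((fun v => complex.Im (f v))).

Lemma ccontinuousD f g : ccontinuous f -> ccontinuous g ->
  ccontinuous (fun v => f v + g v).
Proof.
move=> [rf cf] [rg cg]; split.
  have -> : (fun v => complex.Re (f v + g v)) =
      fun v => complex.Re (f v) + complex.Re (g v) 
    by apply/funext => v /=; rewrite raddfD.
  by move=> x; apply: cvgD; [exact: rf | exact: rg].
have -> : (fun v => complex.Im (f v + g v)) =
    fun v => complex.Im (f v) + complex.Im (g v) 
  by apply/funext => v /=; rewrite raddfD.
by move=> x; apply: cvgD; [exact: cf | exact: cg].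
Qed.

Lemma ccontinuousM f g : ccontinuous f -> ccontinuous g ->
  ccontinuous (fun v => f v * g v).
Proof.
move=> [rf cf] [rg cg]; split.
  have -> : (fun v => complex.Re (f v * g v)) = fun v =>
      complex.Re (f v) * complex.Re (g v) - complex.Im (f v) * complex.Im (g v).
    by apply/funext => v /=; case: (f v) => a b; case: (g v).
  move=> x; apply: cvgB; apply: cvgM; [exact: rf | exact: rg | exact: cf | exact: cg].
have -> : (fun v => complex.Im (f v * g v)) = fun v =>
    complex.Re (f v) * complex.Im (g v) + complex.Im (f v) * complex.Re (g v).
  by apply/funext => v /=; case: (f v) => a b; case: (g v).
by move=> x; apply: cvgD; apply: cvgM; [exact: rf | exact: cg | exact: cf | exact: rg].
Qed.

Lemma ccontinuousC f : ccontinuous f -> ccontinuous (fun v => (f v)^*).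
Proof.
move=> [rf cf]; split.
  have -> : (fun v => complex.Re ((f v)^*)) = (fun v => complex.Re (f v)).
    by apply/funext => v /=; case: (f v).
  exact: rf.
have -> : (fun v => complex.Im ((f v)^*)) = fun v => - complex.Im (f v).
  by apply/funext => v /=; case: (f v).
by move=> x; apply: cvgN; exact: cf.
Qed.

Lemma ccontinuous_cst c : ccontinuous (fun=> c).
Proof. by split=> x; exact: cvg_cst. Qed.

Lemma ccontinuous_sum (I : Type) (r : seq I) (P : pred I) (F : I -> T -> R[i]) :
  (forall i, ccontinuous (F i)) ->
  ccontinuous (fun v => \sum_(i <- r | P i) F i v).
Proof.
move=> cF; elim: r => [|i r IH].
  have -> : (fun v => \sum_(i <- [::] | P i) F i v) = fun=> 0.
    by apply/funext => v; rewrite big_nil.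
  exact: ccontinuous_cst.
have -> : (fun v => \sum_(i <- i :: r | P i) F i v) =
    fun v => (if P i then F i v else 0) + \sum_(i <- r | P i) F i v.
  by apply/funext => v; rewrite big_cons; case: ifP; rewrite ?add0r.
apply: ccontinuousD => //; case: (P i) => //; exact: ccontinuous_cst.
Qed.

Lemma ccontinuous_normX2 f : ccontinuous f -> ccontinuous (fun v => `|f v| ^+ 2).
Proof.
move=> cf; have -> : (fun v => `|f v| ^+ 2) = fun v => f v * (f v)^*.
  by apply/funext => v; rewrite normCK.
by apply: ccontinuousM => //; exact: ccontinuousC.
Qed.

Lemma ccontinuous_mulmx (m n q : nat)
    (F : T -> 'M[R[i]]_(m, n)) (G : T -> 'M[R[i]]_(n, q)) :
  (forall a b, ccontinuous (fun v => F v a b)) ->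
  (forall a b, ccontinuous (fun v => G v a b)) ->
  forall a b, ccontinuous (fun v => (F v *m G v) a b).
Proof.
move=> cF cG a b; have -> : (fun v => (F v *m G v) a b) =
    fun v => \sum_j F v a j * G v j b by apply/funext => v; rewrite mxE.
by apply: ccontinuous_sum => j; exact: ccontinuousM.
Qed.

Lemma ccontinuous_trmxC (m n : nat) (F : T -> 'M[R[i]]_(m, n)) :
  (forall a b, ccontinuous (fun v => F v a b)) ->
  forall a b, ccontinuous (fun v => (F v)^t* a b).
Proof.
move=> cF a b; have -> : (fun v => (F v)^t* a b) = fun v => (F v b a)^*.
  by apply/funext => v; rewrite !mxE.
exact: ccontinuousC.
Qed.

End ComplexContinuity.

Lemma normc_ge_Im (R : rcfType) (x : R[i]) : (`|complex.Im x|)%:C%C <= `|x|.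
Proof.
by case: x => a b; simpc; rewrite -sqrtr_sqr ler_wsqrtr // lerDr sqr_ge0.
Qed.

Lemma unitary_entry_le1 (C : numClosedFieldType) (n : nat) (U : 'M[C]_n) a b :
  U \is unitarymx -> `|U a b| <= 1.
Proof.
move=> /unitarymxP/matrixP/(_ a a); rewrite !mxE eqxx => h.
have : `|U a b| ^+ 2 <= 1.
  rewrite -[leRHS]h (bigD1 b) //= !mxE normCK lerDl sumr_ge0 // => j _.
  by rewrite !mxE mul_conjC_ge0.
by rewrite -[X in _ <= X](expr1n _ 2) ler_pXn2r ?nnegrE.
Qed.

Section UnitaryDefect.
Variables (R : realType) (q : nat).

(** Squared Frobenius distance of [V *m V^t*] from the identity; it presents the unitary matrices as
    the zero set of a continuous function. *)
Definition unitary_defect (V : 'M[R[i]]_q) : R[i] :=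
  \sum_a \sum_b `|(V *m V^t*) a b - (a == b)%:R| ^+ 2.

Lemma unitary_defect_ge0 V : 0 <= unitary_defect V.
Proof. by do 2!rewrite sumr_ge0 // => ? _; rewrite exprn_ge0. Qed.

Lemma unitary_defectP V : V \is unitarymx <-> unitary_defect V = 0.
Proof.
split=> [/unitarymxP VV|d0].
  rewrite /unitary_defect VV big1 // => a _; rewrite big1 // => b _.
  by rewrite mxE subrr normr0 expr0n.
apply/unitarymxP/matrixP => a b; apply/eqP; rewrite [X in _ == X]mxE -subr_eq0 -normr_eq0.
have /eqP := d0; rewrite psumr_eq0 => [/allP/(_ a (mem_index_enum _))/=|a' _]; last first.
  by rewrite sumr_ge0 // => b' _; rewrite exprn_ge0.
rewrite psumr_eq0 => [/allP/(_ b (mem_index_enum _))/=|b' _]; last by rewrite exprn_ge0.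
by rewrite expf_eq0.
Qed.

Lemma ccontinuous_unitary_defect (T : topologicalType) (F : T -> 'M[R[i]]_q) :
  (forall a b, ccontinuous (fun v => F v a b)) ->
  ccontinuous (fun v => unitary_defect (F v)).
Proof.
move=> cF; apply: ccontinuous_sum => a; apply: ccontinuous_sum => b.
apply: ccontinuous_normX2; apply: ccontinuousD; last exact: ccontinuous_cst.
by apply: ccontinuous_mulmx => //; exact: ccontinuous_trmxC.
Qed.

End UnitaryDefect.

Section UnitaryCompactness.
Variables (R : realType) (m n p : nat) (A : 'I_p -> 'M[R[i]]_(m, n)).
Local Notation C := R[i].

Lemma unitary_weight_lower_bound (a0 b0 : nat) :
  (forall U W, U \is unitarymx -> W \is unitarymx ->
    exists (a : 'I_m) (b : 'I_n),
      [/\ (a0 <= a)%N, (b0 <= b)%N & weight A U W a b != 0]) ->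
  exists2 e : R, 0 < e & forall U W, U \is unitarymx -> W \is unitarymx ->
    e <= \sum_(a < m | (a0 <= a)%N) \sum_(b < n | (b0 <= b)%N)
           complex.Re (weight A U W a b).
Proof.
move=> nz.
(* A pair of matrices is coded by the real ([true]) and imaginary ([false]) parts of its entries.
   For unitary matrices these lie in [-1, 1], so the cube contains every code needed. *)
pose I : finType := (('I_n * 'I_n * bool) + ('I_m * 'I_m * bool))%type.
pose N := #|I|.
pose Uv (v : 'rV[R]_N) : 'M[C]_n := \matrix_(a, b)
  (v 0 (enum_rank (inl (a, b, true) : I)) +i* v 0 (enum_rank (inl (a, b, false) : I)))%C.
pose Wv (v : 'rV[R]_N) : 'M[C]_m := \matrix_(a, b)
  (v 0 (enum_rank (inr (a, b, true) : I)) +i* v 0 (enum_rank (inr (a, b, false) : I)))%C.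
have cU a b : ccontinuous (fun v => Uv v a b).
  split; [have -> : (fun v => complex.Re (Uv v a b)) =
      fun v : 'rV[R]_N => v 0 (enum_rank (inl (a, b, true) : I))
    by apply/funext => v; rewrite /= mxE |
    have -> : (fun v => complex.Im (Uv v a b)) =
      fun v : 'rV[R]_N => v 0 (enum_rank (inl (a, b, false) : I))
    by apply/funext => v; rewrite /= mxE]; exact: coord_continuous.
have cW a b : ccontinuous (fun v => Wv v a b).
  split; [have -> : (fun v => complex.Re (Wv v a b)) =
      fun v : 'rV[R]_N => v 0 (enum_rank (inr (a, b, true) : I))
    by apply/funext => v; rewrite /= mxE |
    have -> : (fun v => complex.Im (Wv v a b)) =
      fun v : 'rV[R]_N => v 0 (enum_rank (inr (a, b, false) : I))
    by apply/funext => v; rewrite /= mxE]; exact: coord_continuous.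
pose f v := complex.Re (unitary_defect (Uv v) + unitary_defect (Wv v)).
pose g v := complex.Re (\sum_(a < m | (a0 <= a)%N) \sum_(b < n | (b0 <= b)%N)
   weight A (Uv v) (Wv v) a b).
have cf : continuous f.
  suff [] : ccontinuous (fun v => unitary_defect (Uv v) + unitary_defect (Wv v)) by [].
  by apply: ccontinuousD; exact: ccontinuous_unitary_defect.
have cg : continuous g.
  suff [] : ccontinuous (fun v => \sum_(a < m | (a0 <= a)%N) \sum_(b < n | (b0 <= b)%N)
   weight A (Uv v) (Wv v) a b) by [].
  apply: ccontinuous_sum => a; apply: ccontinuous_sum => b; apply: ccontinuous_sum => i.
  apply: ccontinuous_normX2; apply: ccontinuous_mulmx; last exact: ccontinuous_trmxC.
  by apply: ccontinuous_mulmx => // ? ?; exact: ccontinuous_cst.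
have fP v : f v = 0 <-> Uv v \is unitarymx /\ Wv v \is unitarymx.
  have := unitary_defect_ge0 (Uv v); have := unitary_defect_ge0 (Wv v).
  rewrite !unitary_defectP /f !lecE /=.
  case: (unitary_defect (Uv v)) => a b; case: (unitary_defect (Wv v)) => c d /=.
  move=> /andP[/eqP-> c0] /andP[/eqP-> a0'].
  split=> [/eqP|[[->] [->]]]; last by rewrite addr0.
  by rewrite paddr_eq0 // => /andP[/eqP -> /eqP ->].
have gE v : g v = \sum_(a < m | (a0 <= a)%N) \sum_(b < n | (b0 <= b)%N)
    complex.Re (weight A (Uv v) (Wv v) a b).
  by rewrite /g raddf_sum; apply: eq_bigr => a _; rewrite raddf_sum.
have [|e e0 eP] := compact_pos_lower_bound cf cg.
  move=> v _ /fP[Uu Wu]; rewrite gE; have [a [b [ha hb w0]]] := nz _ _ Uu Wu.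
  rewrite (bigD1 a) //= (bigD1 b) //= -addrA ltr_pwDl //.
    have := weight_ge0 A (Uv v) (Wv v) a b; move: w0.
    rewrite lecE; case: (weight _ _ _ _ _) => c d /= w0 /andP[/eqP dE c0].
    by rewrite lt_def c0 andbT; apply: contra w0 => /eqP ->; rewrite dE.
  rewrite addr_ge0 ?sumr_ge0 // => [b' _|a' _]; first exact: Re_weight_ge0.
  by rewrite sumr_ge0 // => b' _; exact: Re_weight_ge0.
exists e => // U W Uu Wu.
pose h (t : I) : R := match t with
  | inl (a, b, s) => if s then complex.Re (U a b) else complex.Im (U a b)
  | inr (a, b, s) => if s then complex.Re (W a b) else complex.Im (W a b) end.
pose v : 'rV[R]_N := \row_j h (enum_val j).
have UE : Uv v = U.
  by apply/matrixP => a b; rewrite !mxE !enum_rankK /h; case: (U a b).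
have WE : Wv v = W.
  by apply/matrixP => a b; rewrite !mxE !enum_rankK /h; case: (W a b).
have := eP v; rewrite gE UE WE; apply.
  move=> i; rewrite mxE -ler_norml.
  have part q (V : 'M[C]_q) a b : V \is unitarymx ->
      `|complex.Re (V a b)| <= 1 /\ `|complex.Im (V a b)| <= 1.
    move=> Vu; have le1 := unitary_entry_le1 a b Vu; split.
      by have := le_trans (normc_ge_Re (V a b)) le1; rewrite lecE /= => /andP[].
    by have := le_trans (normc_ge_Im (V a b)) le1; rewrite lecE /= => /andP[].
  rewrite /h; case: (enum_val i) => [[[a b] s]|[[a b] s]].
    by have [? ?] := part _ _ a b Uu; case: s.
  by have [? ?] := part _ _ a b Wu; case: s.
by apply/fP; rewrite UE WE.
Qed.

End UnitaryCompactness.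

(** * Auxiliary bounds for sums and logarithms *)

Lemma rowsub_unitary (C : numClosedFieldType) (l q n : nat) (U : 'M[C]_(q, n))
    (h : 'I_l -> 'I_q) :
  injective h -> U \is unitarymx -> rowsub h U \is unitarymx.
Proof.
move=> hinj /unitarymxP/matrixP UU; apply/unitarymxP/matrixP => a b.
have := UU (h a) (h b); rewrite !mxE (inj_eq hinj) => <-.
by apply: eq_bigr => j _; rewrite !mxE.
Qed.

Lemma sum_inj_le (R : numDomainType) (k n : nat) (h : 'I_k -> 'I_n) (D : pred 'I_n)
    (F : 'I_n -> R) : injective h -> (forall b, 0 <= F b) -> (forall c, ~~ D (h c)) ->
  \sum_c F (h c) + \sum_(b | D b) F b <= \sum_b F b.
Proof.
move=> hinj F0 hD.
have -> : \sum_c F (h c) = \sum_(b in codom h) F b.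
  have u : uniq (codom h) by apply/injectiveP.
  by rewrite -(big_uniq _ u) /codom /image_mem big_map big_enum.
rewrite [leRHS](bigID (mem (codom h))) /= lerD2l.
rewrite [leRHS](bigID D) /= -[leLHS]addr0 lerD ?sumr_ge0 //.
rewrite le_eqVlt; apply/orP; left; apply/eqP; apply: eq_bigl => b.
by rewrite andbC; case: (boolP (D b)) => // Db; apply/esym/negP => /codomP[c bE];
  have := hD c; rewrite -bE Db.
Qed.

(** [h] never takes the value [n - r]. The term of [F] there is at least each later one, so it
    dominates the sum of those divided by [n]. *)
Lemma skipping_sum_le (R : realFieldType) (k n r : nat)
    (h : 'I_k -> 'I_n) (F : 'I_n -> R) :
  (0 < n)%N -> (r <= n)%N -> (forall c, h c = bump (n - r) c :> nat) ->
  (forall b, 0 <= F b) -> (forall b b' : 'I_n, (b <= b')%N -> F b' <= F b) ->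
  \sum_c F (h c) + n%:R^-1 * \sum_(b < n | (n - r <= b)%N) F b <= \sum_b F b.
Proof.
move=> n0 rn hE F0 Fd; have hinj : injective h.
  by move=> c c' /(congr1 val); rewrite /= !hE => /(can_inj (@bumpK _))/val_inj.
(* For [r = 0] the index [n - r] is out of range: nothing is skipped and the subtracted sum is
   empty. *)
have [r0|r0] := posnP r.
  rewrite [X in _ * X]big1 => [|b]; last by rewrite r0 subn0 leqNgt ltn_ord.
  by have := sum_inj_le (D := pred0) hinj F0; rewrite big_pred0_eq mulr0; apply.
have dn : (n - r < n)%N by lia.
pose d := Ordinal dn.
have := sum_inj_le (D := pred1 d) hinj F0; rewrite big_pred1_eq => /(_ _)/wrap[].
  by move=> c; rewrite /= -val_eqE /= hE eq_sym neq_bump.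
apply: le_trans; rewrite lerD2l ler_pdivrMl ?ltr0n //.
apply: (@le_trans _ _ (\sum_(b < n | (n - r <= b)%N) F d)).
  by apply: ler_sum => b hb; exact: Fd.
have -> : n%:R * F d = \sum_(b < n) F d by rewrite sumr_const card_ord mulr_natl.
by rewrite [leRHS](bigID (fun b : 'I_n => (n - r <= b)%N)) /= lerDl sumr_ge0.
Qed.

(** The right side is minimal at [t = k]; this is [1 + u <= expR u] at [u = ln (t / k)]. *)
Lemma ln_le_linear (R : realType) (k : nat) (t : R) : (0 < k)%N -> 0 < t ->
  k%:R - k%:R * ln k%:R <= t - k%:R * ln t.
Proof.
move=> k0 t0; have kR : 0 < k%:R :> R by rewrite ltr0n.
have := expR_ge1Dx (ln (t / k%:R)); rewrite lnK ?posrE ?divr_gt0 //.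
rewrite ln_div ?posrE // ler_pdivlMr //; lra.
Qed.

(** * Without violating pairs the functional is bounded below *)

Section BoundedBelow.
Variables (R : realType) (m n p : nat) (A : 'I_p -> 'M[R[i]]_(m, n)).

(** A weight is a sum of squares, so every [W *m A i *m U^t*] has a zero lower right block. The
    conjugated rows of [W] and [U] meeting that block span the pair. *)
Lemma zero_weight_independent U W (a0 b0 : nat) :
  U \is unitarymx -> W \is unitarymx -> (a0 <= m)%N -> (b0 <= n)%N ->
  (forall (a : 'I_m) (b : 'I_n), (a0 <= a)%N -> (b0 <= b)%N -> weight A U W a b = 0) ->
  exists L Rs, [/\ independent A L Rs, \dim L = (m - a0)%N & \dim Rs = (n - b0)%N].
Proof.
move=> Uu Wu am bn w0.
have shift (q q0 : nat) : (q0 <= q)%N -> exists h : 'I_(q - q0) -> 'I_q,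
    injective h /\ forall j, (q0 <= h j)%N.
  move=> qq; have hlt (j : 'I_(q - q0)) : (q0 + j < q)%N by have := ltn_ord j; lia.
  exists (fun j => Ordinal (hlt j)); split=> [i j /(congr1 val) /= /addnI/val_inj //|j].
  exact: leq_addr.
have [ha [hai haP]] := shift _ _ am; have [hb [hbi hbP]] := shift _ _ bn.
have free (q q0 : nat) (h : 'I_q0 -> 'I_q) (V : 'M[R[i]]_q) : injective h ->
    V \is unitarymx -> row_free (rowsub h V).
  by move=> hi Vu; rewrite /row_free mxrank_unitary // rowsub_unitary.
have [L [dL LP]] := rows_vspace (free _ _ _ _ hai Wu).
have [Rs [dR RP]] := rows_vspace (free _ _ _ _ hbi Uu).
exists L, Rs; split=> // x y i /LP[u ->] /RP[v ->].
have WAU : rowsub ha W *m A i *m (rowsub hb U)^t* = 0.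
  apply/matrixP => a b; have /eqP := w0 _ _ (haP a) (hbP b).
  rewrite psumr_eq0 => [/allP/(_ i (mem_index_enum _))/=|j _]; last by rewrite exprn_ge0.
  rewrite expf_eq0 normr_eq0 => /eqP h; rewrite [RHS]mxE -[RHS]h.
  rewrite !mxE; apply: eq_bigr => j _; rewrite !mxE; congr (_ * _).
  by apply: eq_bigr => l _; rewrite !mxE.
rewrite trmx_mul map_mxM trmxCK -!mulmxA (mulmxA (A i)) (mulmxA (rowsub ha W)).
by rewrite (mulmxA (rowsub ha W)) WAU mul0mx mulmx0.
Qed.

Variables (k r : nat).
Hypotheses (n_gt0 : (0 < n)%N) (k_le_n : (k <= n)%N) (r_le_n : (r <= n)%N).
Hypothesis noV : ~ exists (L : {vspace 'cV[R[i]]_m}) (Rs : {vspace 'cV[R[i]]_n}),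
  independent A L Rs /\ violates k r L Rs.

Lemma no_violation_k_le_m : (k <= m)%N.
Proof.
rewrite leqNgt; apply/negP => lt; apply: noV; exists 0%VS, fullv; split.
  move=> x y i; rewrite memv0 => /eqP -> _.
  by rewrite trmx0 map_mx0 !mul0mx.
by left; rewrite dimv0 dim_cV add0n ltn_add2r.
Qed.

(** For [k = n] the pair of the full space and 0 would violate in [r]. The strict inequality leaves
    room for the skipped index [n - r]. *)
Lemma no_violation_k_lt_n : (0 < r)%N -> (k < n)%N.
Proof.
move=> r0; rewrite ltn_neqAle k_le_n andbT; apply/negP => /eqP kn.
apply: noV; exists fullv, 0%VS; split.
  by move=> x y i _; rewrite memv0 => /eqP ->; rewrite mulmx0.
by right; rewrite dimv0 dim_cV addn0 kn addnC.
Qed.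

(** A zero block at position [c] would give an independent pair of dimensions [m - k + 1 + c] and
    [n - bump (n - r) c]. For [c < n - r] it violates in size; for [c >= n - r] its size is
    [m + n - k] and the second dimension, [n - c - 1], is below [r]. *)
Lemma matching_weight_lower_bound :
  exists2 e : R, 0 < e & forall (a : 'I_m) (b : 'I_n) (c : nat) U W,
    (c < k)%N -> a = (k.-1 - c)%N :> nat -> b = bump (n - r) c :> nat ->
    U \is unitarymx -> W \is unitarymx ->
    e <= \sum_(a' < m | (a <= a')%N) \sum_(b' < n | (b <= b')%N)
           complex.Re (weight A U W a' b').
Proof.
have /choice[e eP] : forall c : 'I_k, exists e : R, 0 < e /\
    forall U W, U \is unitarymx -> W \is unitarymx ->
    e <= \sum_(a' < m | (k.-1 - c <= a')%N) \sum_(b' < n | (bump (n - r) c <= b')%N)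
           complex.Re (weight A U W a' b').
  move=> c; have ck := ltn_ord c.
  have [|e e0 eP] := @unitary_weight_lower_bound _ _ _ _ A (k.-1 - c) (bump (n - r) c).
    move=> U W Uu Wu; apply/not_existsP => nex.
    have km := no_violation_k_le_m; have kn := no_violation_k_lt_n.
    have [|||L [Rs [ind dL dR]]] :=
      @zero_weight_independent U W (k.-1 - c) (bump (n - r) c) Uu Wu.
    - lia.
    - by rewrite /bump; case: leqP => h; lia.
    - move=> a b ha hb; apply/eqP; apply: contra_notT (nex a) => w0.
      by exists b.
    apply: noV; exists L, Rs; split=> //; rewrite /violates dL dR /bump.
    case: leqP => h /=; [right | left]; lia.
  by exists e.
(* The default 1 keeps the minimum positive when [k = 0]. *)
pose e0 := \big[Num.min/1]_c e c; exists e0.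
  rewrite /e0; elim/big_ind: _ => // [x y x0 y0|c _]; first by rewrite lt_min x0.
  by have [] := eP c.
move=> a b c U W ck -> -> Uu Wu; have [_ /(_ U W Uu Wu)] := eP (Ordinal ck).
by apply: le_trans; exact: bigmin_le_cond.
Qed.

Lemma no_violation_bounded : (-oo < cap (kraus_map A) k%:R r)%E.
Proof.
have km := no_violation_k_le_m; have kn := no_violation_k_lt_n.
have [e e0 eP] := matching_weight_lower_bound.
(* The minimum over positive [T] of [T - k ln T + k ln e]. For [k = 0] only [T >= 0] is known and
   used. *)
pose B : R := if k == 0%N then 0 else k%:R - k%:R * ln k%:R + k%:R * ln e.
apply/cap_gtNy; exists B => -[[X Y] z] [/= X1 Y1 z0].
have [Xh _ _] := X1; have [Yh _ _] := Y1.
have [U [x [Uu xd XE]]] := hermitian_udiag Xh.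
have [W [y [Wu yd YE]]] := hermitian_udiag Yh.
move: X1 Y1; rewrite XE YE !loewner_udiag // => x1 y1.
have x0 b : 0 < x b by apply: lt_le_trans (x1 b).
have y0 a : 0 < y a by apply: lt_le_trans (y1 a).
rewrite f_kr_udiag //.
set S := \sum_a \sum_b _; set T := S * expR z.
have S0 : 0 <= S.
  rewrite sumr_ge0 // => a _; rewrite sumr_ge0 // => b _.
  by rewrite divr_ge0 ?Re_weight_ge0 // mulr_ge0 // ltW.
have lnx0 b : 0 <= ln (x b) by rewrite ln_ge0.
have lny0 a : 0 <= ln (y a) by rewrite ln_ge0.
have lnxd (b b' : 'I_n) : (b <= b')%N -> ln (x b') <= ln (x b).
  by move=> bb'; rewrite ler_ln ?posrE // xd.
have hlt (c : 'I_k) : (bump (n - r) c < n)%N.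
  by have := ltn_ord c; rewrite /bump; case: leqP => h; lia.
have glt (c : 'I_k) : (k.-1 - c < m)%N by have := ltn_ord c; lia.
pose h c := Ordinal (hlt c); pose g c := Ordinal (glt c).
have sx := @skipping_sum_le _ k n r h (fun b => ln (x b))
  n_gt0 r_le_n (fun=> erefl) lnx0 lnxd.
have sy : \sum_c ln (y (g c)) <= \sum_a ln (y a).
  have ginj : injective g.
    move=> c c' /(congr1 val) /= cc; apply/val_inj => /=.
    by have := ltn_ord c; have := ltn_ord c'; lia.
  have := sum_inj_le (D := pred0) ginj lny0; by rewrite big_pred0_eq addr0; apply.
have [k0|k0] := posnP k.
  rewrite /B k0 eqxx mul0r; move: sx sy.
  have -> : \sum_c ln (x (h c)) = 0.
    by apply: big1 => c _; have := ltn_ord c; rewrite {2}k0.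
  have -> : \sum_c ln (y (g c)) = 0.
    by apply: big1 => c _; have := ltn_ord c; rewrite {2}k0.
  have : 0 <= T by rewrite mulr_ge0 // expR_ge0.
  lra.
(* In the block starting at [(g c, h c)] the weights add up to at least [e], and by monotonicity
   each is divided by at most [x (h c) * y (g c)]. *)
have key c : e * expR z <= T * (x (h c) * y (g c)).
  rewrite /T mulrAC ler_pM2r ?expR_gt0 //.
  apply: le_trans (eP (g c) (h c) c U W (ltn_ord c) erefl erefl Uu Wu) _.
  rewrite /S mulr_suml [leRHS](bigID (fun a : 'I_m => (g c <= a)%N)) /=.
  rewrite -[leLHS]addr0 lerD //; last first.
    rewrite sumr_ge0 // => a _; rewrite mulr_suml sumr_ge0 // => b _.
    by rewrite !mulr_ge0 ?Re_weight_ge0 ?invr_ge0 // ?mulr_ge0 // ltW.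
  apply: ler_sum => a ha; rewrite mulr_suml.
  rewrite [leRHS](bigID (fun b : 'I_n => (h c <= b)%N)) /=.
  rewrite -[leLHS]addr0 lerD //; last first.
    rewrite sumr_ge0 // => b _.
    by rewrite !mulr_ge0 ?Re_weight_ge0 ?invr_ge0 // ?mulr_ge0 // ltW.
  apply: ler_sum => b hb; rewrite mulrAC ler_pdivlMr ?mulr_gt0 //.
  rewrite ler_wpM2l ?Re_weight_ge0 //.
  by apply: ler_pM; [exact: ltW | exact: ltW | exact: xd | exact: yd].
have T0 : 0 < T.
  have h0 := key (Ordinal k0).
  have : 0 < T * (x (h (Ordinal k0)) * y (g (Ordinal k0))).
    by apply: lt_le_trans h0; rewrite mulr_gt0 // expR_gt0.
  by rewrite pmulr_lgt0 // mulr_gt0.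
clearbody T; have lnkey c : ln e + z - ln T <= ln (x (h c)) + ln (y (g c)).
  have := key c; rewrite -ler_ln ?posrE ?mulr_gt0 ?expR_gt0 //.
  rewrite !lnM ?posrE ?mulr_gt0 ?expR_gt0 // expRK; lra.
(* Summing the [k] inequalities produces [k z], which cancels the term [- k z] of the functional. *)
have sumkey : k%:R * (ln e + z - ln T) <= \sum_c ln (x (h c)) + \sum_c ln (y (g c)).
  rewrite -big_split /=; apply: le_trans (ler_sum _ (fun c _ => lnkey c)).
  by rewrite sumr_const card_ord mulr_natl.
have := ln_le_linear k0 T0; rewrite /B gtn_eqF //.
move: sx sy sumkey; rewrite !mulrBr mulrDr; lra.
Qed.

End BoundedBelow.

(** * The cycle of implications *)

Theorem theorem3p10 (R : realType) (m n p : nat)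
    (A : 'I_p -> 'M[R[i]]_(m, n)) (k r : nat)
    (n_gt0 : (0 < n)%N) (k_le_n : (k <= n)%N) (r_le_n : (r <= n)%N) :
  [<-> lex_le (k, r) (kstar A, rstar A);
       ~ (exists (L : {vspace 'cV[R[i]]_m}) (Rs : {vspace 'cV[R[i]]_n}),
            independent A L Rs /\ violates k r L Rs);
       (-oo < cap (kraus_map A) k%:R r)%E;
       (-oo < cap (kraus_map A) (k%:R - (2 * n%:R)^-1) r)%E].
Proof.
split; first by move/lex_le_no_violation.
split; first exact: no_violation_bounded.
split; first by apply: cap_antitone; rewrite gerBl invr_ge0 mulr_ge0.
move=> bnd; apply/lex_le_no_violation => -[L [Rs [ind vio]]].
exact: (violation_unbounded n_gt0 r_le_n ind vio).
Qed.
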